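(* The well-definedness problem for the language $\mathrm{PERX}^-$ is undecidable: for every choice of the computable oracle functions $\mathit{content}$ and $\mathit{concat}$, there is no algorithm which, given a $\mathrm{PERX}^-$ expression $e$ and an assignment $\Gamma$ of RX-types to the free variables of $e$, decides whether $e(\sigma)$ is defined for every environment $\sigma\in\Gamma$.
   Context: **Values.** $\mathcal A$ is an infinite recursively enumerable set of atoms. Nodes are defined inductively: a node is an element node $\langle a:N\rangle$ or a data node $\langle a\rangle$, where $a\in\mathcal A$ and $N$ is a finite set of nodes. An item is an atom or a node. An RX-value is a finite set of items. **Types.** RX-types $\tau$ are generated by $\tau::=\mathbf{coll}(\iota)\mid\mathbf{single}(\iota)$; $\iota::=\mathbf{atom}\mid\nu\mid\iota\cup\iota$; $\nu::=\mathbf{data}\mid\mathbf{elem}(\gamma)\mid\nu\cup\nu$; $\gamma::=\mathbf{coll}(\nu)\mid\mathbf{single}(\nu)$. Denotations: $\mathbf{atom}$ is $\mathcal A$; $\mathbf{data}$ is the set of all data nodes; $\mathbf{elem}(\gamma)$ is the set of all $\langle a:N\rangle$ with $N$ in the denotation of $\gamma$; $\cup$ is union; $\mathbf{coll}(\iota)$ is the set of all finite subsets of the denotation of $\iota$; $\mathbf{single}(\iota)$ is the set of all singleton subsets of the denotation of $\iota$. Types are identified with their denotations. **Expressions.** $\mathrm{PERX}^-$ expressions are generated by $$e::=x\mid elem\{e\}\{e\}\mid name(e)\mid children(e)\mid()\mid e,e\mid for\ x\ in\ e\ return\ e\mid if\ e\ eq\ e\ then\ e\ else\ e,$$ where $x$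 ranges over an infinite set of variables. In ''$for\ x\ in\ e_1\ return\ e_2$'' the variable $x$ is bound in $e_2$; $FV(e)$ is the set of free variables of $e$. **Semantics.** Fix computable oracle functions $\mathit{content}$ (element nodes to atoms) and $\mathit{concat}$ (finite sets of atoms to atoms). For values $v,w$: $data(v)=\{a\mid a\in v \text{ an atom}\}\cup\{a\mid\langle a\rangle\in v\}\cup\{\mathit{content}(\langle a:N\rangle)\mid\langle a:N\rangle\in v\}$; $name(v)=\{a\}$ if $v=\{\langle a:N\rangle\}$, $name(\emptyset)=\{\mathit{concat}(\emptyset)\}$, undefined otherwise; $children(v)$ is undefined if $v$ contains an atom, and otherwise is $\bigcup\{N\mid\langle a:N\rangle\in v\}$; $construct(v,w)$ is undefined if $data(v)$ is not a singleton $\{a\}$, and otherwise is $\langle a:N\rangle$ with $N=\{\langle b\rangle\mid b\in w\text{ an atom}\}\cup\{i\in w\mid i\text{ a node}\}$. An environment $\sigma$ on $e$ maps each $x\in FV(e)$ to an RX-value; $x:v,\sigma$ denotes $\sigma$ updated to send $x$ to $v$. The partial semantics is: $x(\sigma)=\sigma(x)$; $elem\{e_1\}\{e_2\}(\sigma)=\{construct(e_1(\sigma),e_2(\sigma))\}$; $name(e)(\sigma)=name(e(\sigma))$; $children(e)(\sigma)=children(e(\sigma))$; $()(\sigma)=\emptyset$; $(e_1,e_2)(\sigma)=e_1(\sigma)\cup e_2(\sigma)$; $(for\ x\ in\ e_1\ return\ e_2)(\sigma)=\bigcup\{e_2(x:\{i\},\sigma)\mid i\in e_1(\sigma)\}$;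 $(if\ e_1\ eq\ e_2\ then\ e_3\ else\ e_4)(\sigma)$ is $e_3(\sigma)$ if $data(e_1(\sigma))=data(e_2(\sigma))=\{a\}$ for an atom $a$, is $e_4(\sigma)$ if $data(e_1(\sigma))=\{a\}$ and $data(e_2(\sigma))=\{b\}$ for atoms $a\ne b$, and is undefined otherwise. An expression is undefined whenever a value it refers to in its defining clause is undefined (branches not taken are not evaluated). **Type assignments.** A type assignment $\Gamma$ on $e$ maps each $x\in FV(e)$ to an RX-type. $\sigma\in\Gamma$ means that $\sigma$ and $\Gamma$ have the same domain and $\sigma(x)\in\Gamma(x)$ for all $x$. *)

(* Defs.v *)
From HB Require Import structures.
From mathcomp Require Import all_boot finmap.
From mathcomp Require Import classical_sets cardinality.

Set Implicit Arguments.
Unset Strict Implicit.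
Unset Printing Implicit Defensive.

Local Open Scope fset_scope.
Local Open Scope fmap_scope.

(* Kleene's partial recursive functions.  Programs are not indexed by their
   arity; a program applied to too few arguments has no value. *)
Inductive prf : Type :=
| PZero
| PSucc
| PProj of nat
| PComp of prf & seq prf
| PRec of prf & prf
| PMu of prf.

Inductive computes : prf -> seq nat -> nat -> Prop :=
| computes_zero xs : computes PZero xs 0
| computes_succ x xs : computes PSucc (x :: xs) x.+1
| computes_proj i xs : i < size xs -> computes (PProj i) xs (nth 0 xs i)
| computes_comp f gs xs ys y :
    size ys = size gs ->
    (forall i, i < size gs -> computes (nth PZero gs i) xs (nth 0 ys i)) ->
    computes f ys y ->
    computes (PComp f gs) xs y
| computes_rec0 f g xs y :
    computes f xs y -> computes (PRec f g) (0 :: xs) y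
| computes_recS f g n xs r y :
    computes (PRec f g) (n :: xs) r -> computes g [:: n, r & xs] y ->
    computes (PRec f g) (n.+1 :: xs) y
| computes_mu f xs n (k : nat -> nat) :
    (forall m, m < n -> computes f (m :: xs) (k m).+1) ->
    computes f (n :: xs) 0 ->
    computes (PMu f) xs n.

Lemma computes_fun f xs y y' : computes f xs y -> computes f xs y' -> y = y'.
Proof.
move=> c; elim: c y' => {f xs y}.
- by move=> xs y' c; inversion c.
- by move=> x xs y' c; inversion c.
- by move=> i xs _ y' c; inversion c.
- move=> f gs xs ys y sz _ IHg _ IHf y' c; inversion c as [| | |? ? ? zs ? sz' cg cf| | |].
  subst; apply: IHf; suff -> : ys = zs by [].
  apply: (@eq_from_nth _ 0) => [|i lt_i]; first by rewrite sz sz'.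
  by apply: IHg; rewrite -?sz //; apply: cg; rewrite -sz.
- by move=> f g xs y _ IH y' c; inversion c; subst; apply: IH.
- move=> f g n xs r y _ IHr _ IHy y' c; inversion c as [| | | | |? ? ? ? r' ? cr cy|].
  by subst; apply: IHy; rewrite (IHr _ cr).
- move=> f xs n k _ IHlt _ IHn y' c; inversion c as [| | | | | |? ? ? k' c_lt c_n].
  subst; case: (ltngtP n y') => // [lt_n|lt_y].
    by have := IHn _ (c_lt _ lt_n).
  by have := IHlt _ lt_y _ c_n.
Qed.

Definition recursively_enumerable (A : set nat) : Prop :=
  exists f : prf, forall n, A n <-> exists y, computes f [:: n] y.

(* Cantor's pairing function. *)
Definition cpair (x y : nat) : nat := 'C((x + y).+1, 2) + y.

Definition code_seq (s : seq nat) : nat :=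
  foldr (fun x c => (cpair x c).+1) 0 s.

Lemma cpair_inj x y x' y' : cpair x y = cpair x' y' -> x = x' /\ y = y'.
Proof.
have lt_step u v u' v' : u + v < u' + v' -> cpair u v < cpair u' v'.
  move=> lt_uv; rewrite /cpair; apply: leq_trans (leq_addr _ _).
  have: 'C((u + v).+2, 2) <= 'C((u' + v').+1, 2) by apply: leq_bin2l.
  apply: leq_trans; rewrite [X in _ <= X]binS bin1 ltn_add2l ltnS.
  exact: leq_addl.
move=> e; have [lt|lt|eq_s] := ltngtP (x + y) (x' + y').
- by have := lt_step _ _ _ _ lt; rewrite e ltnn.
- by have := lt_step _ _ _ _ lt; rewrite e ltnn.
move: e; rewrite /cpair eq_s => /addnI eq_y; split=> //.
by move: eq_s; rewrite eq_y => /addIn.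
Qed.

Lemma code_seq_inj : injective code_seq.
Proof.
elim=> [|x s IHs] [|y t] //= [/cpair_inj[-> /IHs ->]].
by [].
Qed.

Section Values.
Variable A : set nat.

Definition atom : Type := A.
HB.instance Definition _ := Countable.on atom.

Definition code_atom (a : atom) : nat := val a.

(* Nodes are the trees below whose lists of children are strictly sorted with
   respect to [code_tree], hereditarily; strict sortedness makes each finite
   set of children have a unique representation as a list. *)
Inductive tree : Type :=
| TData of atom
| TElem of atom & seq tree.

Lemma tree_nested_ind (P : tree -> Prop) :
  (forall a, P (TData a)) ->
  (forall a s, (forall i, i < size s -> P (nth (TData a) s i)) ->
     P (TElem a s)) ->
  forall t, P t.
Proof.
move=> Pd Pe; fix IH 1; case=> [a|a s]; first exact: Pd.
apply: Pe; elim: s => [i|t s IHs [_|i lt_i]]; first discriminate.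
  exact: (IH t).
exact: (IHs i lt_i).
Qed.

Fixpoint tree_enc (t : tree) : GenTree.tree atom :=
  match t with
  | TData a => GenTree.Leaf a
  | TElem a s => GenTree.Node 0 (GenTree.Leaf a :: map tree_enc s)
  end.

Fixpoint tree_dec (g : GenTree.tree atom) : option tree :=
  match g with
  | GenTree.Leaf a => Some (TData a)
  | GenTree.Node _ (GenTree.Leaf a :: s) => Some (TElem a (pmap tree_dec s))
  | _ => None
  end.

Lemma tree_encK : pcancel tree_enc tree_dec.
Proof.
elim/tree_nested_ind=> [a|a s IHs] //=; congr (Some (TElem a _)).
elim: s IHs => [|t s IHs] //= IH; rewrite (IH 0) //=; congr cons.
by apply: IHs => i; apply: (IH i.+1).
Qed.

HB.instance Definition _ := Countable.copy tree (pcan_type tree_encK).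

Fixpoint code_tree (t : tree) : nat :=
  match t with
  | TData a => cpair 0 (code_atom a)
  | TElem a s => cpair 1 (cpair (code_atom a) (code_seq (map code_tree s)))
  end.

Lemma code_tree_inj : injective code_tree.
Proof.
elim/tree_nested_ind=> [a|a s IHs] [b|b s'] /=.
- by case/cpair_inj=> _ /val_inj ->.
- by move/cpair_inj=> [].
- by move/cpair_inj=> [].
case/cpair_inj=> _ /cpair_inj[/val_inj eq_ab /code_seq_inj].
rewrite -eq_ab => eq_s; congr TElem.
elim: s s' IHs eq_s => [|t s IH] [|t' s'] //= IHs [eq_t eq_s].
congr cons; first exact: (IHs 0 isT _ eq_t).
by apply: IH => // i; apply: (IHs i.+1).
Qed.

Definition tree_le : rel tree := relpre code_tree leq.
Definition tree_lt : rel tree := relpre code_tree ltn.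

Fixpoint canonical_tree (t : tree) : bool :=
  match t with
  | TData _ => true
  | TElem _ s => sorted tree_lt s && all canonical_tree s
  end.

Record node : Type := Node { node_tree : tree; _ : canonical_tree node_tree }.

HB.instance Definition _ := [isSub for node_tree].
HB.instance Definition _ := [Countable of node by <:].

Definition code_node (n : node) : nat := code_tree (node_tree n).

Definition dnode (a : atom) : node := @Node (TData a) isT.

Fact enode_subproof (a : atom) (N : {fset node}) :
  canonical_tree (TElem a (sort tree_le (map node_tree (enum_fset N)))).
Proof.
rewrite /=; apply/andP; split.
  rewrite /tree_lt -sorted_map ltn_sorted_uniq_leq map_inj_uniq; last exact: code_tree_inj.
  rewrite sort_uniq (map_inj_uniq val_inj) fset_uniq /= sorted_map.
  by apply: sort_sorted => t u; apply: leq_total.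
rewrite all_sort all_map; apply/allP => n _; exact: valP.
Qed.

Definition enode (a : atom) (N : {fset node}) : node :=
  Node (enode_subproof a N).

Variant node_shape : Type :=
| DataNode of atom
| ElemNode of atom & {fset node}.

Definition shape (n : node) : node_shape :=
  match node_tree n with
  | TData a => DataNode a
  | TElem a s => ElemNode a [fset m in pmap insub s]
  end.

Definition unshape (s : node_shape) : node :=
  match s with
  | DataNode a => dnode a
  | ElemNode a N => enode a N
  end.

(* [shape] and [unshape] are mutually inverse, and nodes satisfy the induction
   principle of the inductive definition <a> | <a : N> with N a finite set. *)
Lemma unshapeK : cancel unshape shape.
Proof.
case=> [a|a N] //; rewrite /shape /=; congr ElemNode.
apply/fsetP => m; rewrite in_fset /= mem_pmap_sub mem_sort.
by rewrite (mem_map val_inj).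
Qed.

Lemma shapeK : cancel shape unshape.
Proof.
case=> [[a|a s] cs]; apply: val_inj; rewrite //= /shape /=; congr TElem.
have /andP[s_lt s_can] := cs.
have lt_trans : transitive tree_lt by move=> x y z; apply: ltn_trans.
have lt_irr : irreflexive tree_lt by move=> x; apply: ltnn.
have := valP (enode a [fset m in pmap insub s]); rewrite /= => /andP[t_lt _].
apply: (irr_sorted_eq lt_trans lt_irr t_lt s_lt) => t.
rewrite mem_sort; apply/mapP/idP => [[m + ->]|ts].
  by rewrite in_fset /= mem_pmap_sub.
have ct := allP s_can t ts; exists (Node ct) => //.
by rewrite in_fset /= mem_pmap_sub.
Qed.

Lemma node_ind (P : node -> Prop) :
  (forall a, P (dnode a)) ->
  (forall a (N : {fset node}), (forall n, n \in N -> P n) -> P (enode a N)) ->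
  forall n, P n.
Proof.
move=> Pd Pe [t]; elim/tree_nested_ind: t => [a|a s IHs] ct.
  by rewrite (_ : Node ct = dnode a) //; apply: val_inj.
rewrite -[Node ct]shapeK {1}/shape /=; apply: Pe => n.
rewrite in_fset /= mem_pmap_sub => n_s.
have := IHs (index (val n) s); rewrite index_mem nth_index // => /(_ n_s).
by case: n {n_s} => t ct' /=; apply.
Qed.

Definition item : Type := (atom + node)%type.
HB.instance Definition _ := Countable.on item.

Definition value : Type := {fset item}.

Definition code_atoms (S : {fset atom}) : nat :=
  code_seq (sort leq (map code_atom (enum_fset S))).

End Values.

Definition computable_content (A : set nat)
    (content : atom A -> {fset node A} -> atom A) : Prop :=
  exists f : prf, forall a N,
    computes f [:: code_node (enode a N)] (code_atom (content a N)).

Definition computable_concat (A : set nat)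
    (concat : {fset atom A} -> atom A) : Prop :=
  exists f : prf, forall S,
    computes f [:: code_atoms S] (code_atom (concat S)).

Inductive ntype : Type :=
| Data
| Elem of gtype
| NUnion of ntype & ntype
with gtype : Type :=
| GColl of ntype
| GSingle of ntype.

Inductive itype : Type :=
| IAtom
| INode of ntype
| IUnion of itype & itype.

Inductive rxtype : Type :=
| Coll of itype
| Single of itype.

Section Denotations.
Variable A : set nat.

Fixpoint in_ntype (t : ntype) (n : node A) : Prop :=
  match t with
  | Data => exists a, n = dnode a
  | Elem g => exists a N, n = enode a N /\ in_gtype g N
  | NUnion t1 t2 => in_ntype t1 n \/ in_ntype t2 n
  end
with in_gtype (g : gtype) (N : {fset node A}) : Prop :=
  match g with
  | GColl t => forall n, n \in N -> in_ntype t n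
  | GSingle t => exists n, N = [fset n] /\ in_ntype t n
  end.

Fixpoint in_itype (t : itype) (i : item A) : Prop :=
  match t with
  | IAtom => exists a, i = inl a
  | INode u => exists n, i = inr n /\ in_ntype u n
  | IUnion t1 t2 => in_itype t1 i \/ in_itype t2 i
  end.

Definition in_rxtype (t : rxtype) (v : value A) : Prop :=
  match t with
  | Coll u => forall i, i \in v -> in_itype u i
  | Single u => exists i, v = [fset i] /\ in_itype u i
  end.

End Denotations.

Definition var : Type := nat.

Inductive expr : Type :=
| EVar of var
| EElem of expr & expr
| EName of expr
| EChildren of expr
| EEmpty
| ESeq of expr & expr
| EFor of var & expr & expr          (* for x in e1 return e2 *)
| EIf of expr & expr & expr & expr.  (* if e1 eq e2 then e3 else e4 *)

Fixpoint FV (e : expr) : {fset nat} :=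
  match e with
  | EVar x => [fset x]
  | EElem e1 e2 => FV e1 `|` FV e2
  | EName e1 => FV e1
  | EChildren e1 => FV e1
  | EEmpty => fset0
  | ESeq e1 e2 => FV e1 `|` FV e2
  | EFor x e1 e2 => FV e1 `|` (FV e2 `\ x)
  | EIf e1 e2 e3 e4 => FV e1 `|` FV e2 `|` FV e3 `|` FV e4
  end.

Section Semantics.
Variable A : set nat.
Variable content : atom A -> {fset node A} -> atom A.
Variable concat : {fset atom A} -> atom A.

Definition data_item (i : item A) : atom A :=
  match i with
  | inl a => a
  | inr n => match shape n with
             | DataNode a => a
             | ElemNode a N => content a N
             end
  end.

Definition data (v : value A) : {fset atom A} := [fset data_item i | i in v].

Definition the_atom (S : {fset atom A}) : option (atom A) :=
  if enum_fset S is [:: a] then Some a else None.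

Lemma the_atomP (S : {fset atom A}) a : the_atom S = Some a <-> S = [fset a].
Proof.
rewrite /the_atom; split=> [|->]; last by rewrite -fset_seq1.
case e: (enum_fset S) => [|b [|c r]] //= [<-].
by apply: val_inj; rewrite /= e fset_seq1.
Qed.

Definition name (v : value A) : option (value A) :=
  match enum_fset v with
  | [::] => Some [fset inl (concat fset0)]
  | [:: inr n] => if shape n is ElemNode a _ then Some [fset inl a] else None
  | _ => None
  end.

Lemma name0 : name fset0 = Some [fset inl (concat fset0)].
Proof. by rewrite /name (size0nil (cardfs0 _)). Qed.

Lemma name_enode a N : name [fset inr (enode a N)] = Some [fset inl a].
Proof. by rewrite /name -fset_seq1 (unshapeK (ElemNode a N)). Qed.

Definition is_atom (i : item A) : bool := if i is inl _ then true else false.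

Definition children_item (i : item A) : value A :=
  match i with
  | inl _ => fset0
  | inr n => match shape n with
             | DataNode _ => fset0
             | ElemNode _ N => [fset (inr m : item A) | m in N]
             end
  end.

Definition children (v : value A) : option (value A) :=
  if has is_atom (enum_fset v) then None
  else Some (\bigcup_(i <- enum_fset v) children_item i).

Definition item_to_node (i : item A) : node A :=
  match i with
  | inl b => dnode b
  | inr n => n
  end.

Definition construct (v w : value A) : option (node A) :=
  omap (fun a => enode a [fset item_to_node i | i in w]) (the_atom (data v)).

(* [None] stands for "undefined". *)
Fixpoint eval (e : expr) (s : {fmap var -> value A}) : option (value A) :=
  match e with
  | EVar x => s.[? x]
  | EElem e1 e2 =>
      match eval e1 s, eval e2 s with
      | Some v, Some w => omap (fun n => [fset inr n]) (construct v w)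
      | _, _ => None
      end
  | EName e1 => obind name (eval e1 s)
  | EChildren e1 => obind children (eval e1 s)
  | EEmpty => Some fset0
  | ESeq e1 e2 =>
      match eval e1 s, eval e2 s with
      | Some v, Some w => Some (v `|` w)
      | _, _ => None
      end
  | EFor x e1 e2 =>
      match eval e1 s with
      | Some v =>
          let rs := [seq eval e2 s.[x <- [fset i]] | i <- enum_fset v] in
          if all isSome rs then Some (\bigcup_(r <- rs) odflt fset0 r)
          else None
      | None => None
      end
  | EIf e1 e2 e3 e4 =>
      match obind (fun v => the_atom (data v)) (eval e1 s),
            obind (fun v => the_atom (data v)) (eval e2 s) with
      | Some a, Some b => if a == b then eval e3 s else eval e4 s
      | _, _ => None
      end
  end.

Definition env_in (s : {fmap var -> value A}) (G : {fmap var -> rxtype}) :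
    Prop :=
  domf s = domf G /\
  forall x v t, s.[? x] = Some v -> G.[? x] = Some t -> in_rxtype t v.

Definition well_defined (e : expr) (G : {fmap var -> rxtype}) : Prop :=
  forall s, env_in s G -> exists v, eval e s = Some v.

End Semantics.

Fixpoint code_ntype (t : ntype) : nat :=
  match t with
  | Data => cpair 0 0
  | Elem g => cpair 1 (code_gtype g)
  | NUnion t1 t2 => cpair 2 (cpair (code_ntype t1) (code_ntype t2))
  end
with code_gtype (g : gtype) : nat :=
  match g with
  | GColl t => cpair 0 (code_ntype t)
  | GSingle t => cpair 1 (code_ntype t)
  end.

Fixpoint code_itype (t : itype) : nat :=
  match t with
  | IAtom => cpair 0 0
  | INode u => cpair 1 (code_ntype u)
  | IUnion t1 t2 => cpair 2 (cpair (code_itype t1) (code_itype t2))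
  end.

Definition code_rxtype (t : rxtype) : nat :=
  match t with
  | Coll u => cpair 0 (code_itype u)
  | Single u => cpair 1 (code_itype u)
  end.

Fixpoint code_expr (e : expr) : nat :=
  match e with
  | EVar x => cpair 0 x
  | EElem e1 e2 => cpair 1 (cpair (code_expr e1) (code_expr e2))
  | EName e1 => cpair 2 (code_expr e1)
  | EChildren e1 => cpair 3 (code_expr e1)
  | EEmpty => cpair 4 0
  | ESeq e1 e2 => cpair 5 (cpair (code_expr e1) (code_expr e2))
  | EFor x e1 e2 => cpair 6 (cpair x (cpair (code_expr e1) (code_expr e2)))
  | EIf e1 e2 e3 e4 =>
      cpair 7 (cpair (cpair (code_expr e1) (code_expr e2))
                     (cpair (code_expr e3) (code_expr e4)))
  end.

(* The graph of G, listed by increasing variables. *)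
Definition code_assignment (G : {fmap var -> rxtype}) : nat :=
  code_seq (pmap (fun x : var => omap (fun t => cpair x (code_rxtype t)) G.[? x])
                 (sort leq (enum_fset (domf G)))).

Scheme ntype_gtype_ind := Induction for ntype Sort Prop
  with gtype_ntype_ind := Induction for gtype Sort Prop.

Lemma code_ntype_inj : injective code_ntype.
Proof.
move=> t; pose P u := forall u', code_ntype u = code_ntype u' -> u = u'.
pose Q g := forall g', code_gtype g = code_gtype g' -> g = g'.
apply: (@ntype_gtype_ind P Q) => {t} [|g IH|t1 IH1 t2 IH2|t IH|t IH].
- by case=> [|?|? ?] /cpair_inj[].
- by case=> [|?|? ?] /cpair_inj[//] _ /IH ->.
- by case=> [|?|? ?] /cpair_inj[//] _ /cpair_inj[/IH1 -> /IH2 ->].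
- by case=> ? /cpair_inj[//] _ /IH ->.
- by case=> ? /cpair_inj[//] _ /IH ->.
Qed.

Lemma code_rxtype_inj : injective code_rxtype.
Proof.
have inj_i : injective code_itype.
  elim=> [|u|t1 IH1 t2 IH2] [|u'|t1' t2'] /cpair_inj[] //.
  - by move=> _ /code_ntype_inj ->.
  - by move=> _ /cpair_inj[/IH1 -> /IH2 ->].
by case=> u [] u' /cpair_inj[] // _ /inj_i ->.
Qed.

Lemma code_expr_inj : injective code_expr.
Proof.
elim=> [x|e1 I1 e2 I2|e1 I1|e1 I1||e1 I1 e2 I2|x e1 I1 e2 I2
       |e1 I1 e2 I2 e3 I3 e4 I4]; case=> *;
  match goal with H : code_expr _ = _ |- _ => move: H end;
  case/cpair_inj=> // _.
- by move=> ->.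
- by case/cpair_inj=> /I1 -> /I2 ->.
- by move/I1 ->.
- by move/I1 ->.
- by case/cpair_inj=> /I1 -> /I2 ->.
- by case/cpair_inj=> -> /cpair_inj[/I1 -> /I2 ->].
- by case/cpair_inj=> /cpair_inj[/I1 -> /I2 ->] /cpair_inj[/I3 -> /I4 ->].
Qed.

Lemma code_assignment_inj : injective code_assignment.
Proof.
move=> G G' /code_seq_inj eq_GG'.
pose L (H : {fmap var -> rxtype}) :=
  pmap (fun x : var => omap (fun t => cpair x (code_rxtype t)) H.[? x])
       (sort leq (enum_fset (domf H))).
have memL H x t : (cpair x (code_rxtype t) \in L H) <-> H.[? x] = Some t.
  rewrite mem_pmap; split=> [/mapP[y _]|Hx].
    by case e: H.[? y] => [u|] //= [/cpair_inj[-> /code_rxtype_inj ->]].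
  by apply/mapP; exists x; rewrite ?Hx // mem_sort -fndSome Hx.
apply/fmapP => x; have eL : L G = L G' by [].
case Gx: G.[? x] => [t|]; first by move/memL: Gx; rewrite eL => /memL ->.
case G'x: G'.[? x] => [t|] //.
by move/memL: G'x; rewrite -eL => /memL; rewrite Gx.
Qed.

(* Main.v *)
Require Import Defs.
From mathcomp Require Import all_boot finmap.
From mathcomp Require Import boolp classical_sets functions cardinality.

(* With input a set of nodes <a:{<b:{<c>}>}>, that is, a finite ternary relation
   on atoms, PERX^- evaluates all first-order sentences; negation works because
   name(()) is defined.  Hence an expression can be undefined exactly on the finite
   models of a sentence, and well-definedness amounts to the absence of finite
   models.  For a partial recursive f there is a sentence whose finite models
   are tables of values, closed under the justification of each value by the
   defining clauses of f, that contain a value of f at n.  Justifications are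
   well-founded since the numbers lie on a chain of predecessors ending in zero, so
   such a table exists iff f is defined at n.  The input n only appears as a
   context iterated n times around an expression e_f, so that the code of the
   instance is a simple function of n and the code of e_f.  A decision procedure
   then yields a g that is defined at the code of e_g iff it is undefined there. *)

Set Implicit Arguments.
Unset Strict Implicit.
Unset Printing Implicit Defensive.

(** * Computable functions of codes *)

Definition computable1 (F : nat -> nat) :=
  exists p, forall xs x, computes p (x :: xs) (F x).

Definition computable2 (F : nat -> nat -> nat) :=
  exists p, forall xs x y, computes p [:: x, y & xs] (F x y).

Lemma computes_comp1 f g xs x y :
  computes g xs x -> computes f [:: x] y -> computes (PComp f [:: g]) xs y.
Proof.
by move=> cg cf; apply: (@computes_comp _ _ _ [:: x]) => // -[].
Qed.

Lemma computes_comp2 f g h xs x y z :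
  computes g xs x -> computes h xs y -> computes f [:: x; y] z ->
  computes (PComp f [:: g; h]) xs z.
Proof.
by move=> cg ch cf; apply: (@computes_comp _ _ _ [:: x; y]) => // -[|[]].
Qed.

Lemma computable1_id : computable1 id.
Proof. by exists (PProj 0) => xs x; apply: (@computes_proj 0). Qed.

Lemma const_computable c : exists p, forall xs, computes p xs c.
Proof.
elim: c => [|c [p cp]]; first by exists PZero; constructor.
exists (PComp PSucc [:: p]) => xs.
by apply: computes_comp1 (cp xs) _; constructor.
Qed.

Lemma computable1_const c : computable1 (fun=> c).
Proof. by have [p cp] := const_computable c; exists p. Qed.

Lemma addn_computable : computable2 addn.
Proof.
exists (PRec (PProj 0) (PComp PSucc [:: PProj 1])) => xs x y.
elim: x => [|x IH]; first by constructor; apply: (@computes_proj 0).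
apply: computes_recS IH _; apply: computes_comp1; last by constructor.
exact: (@computes_proj 1).
Qed.

Lemma triangle_computable : computable1 (fun x => 'C(x.+1, 2)).
Proof.
have [p cp] := addn_computable.
exists (PRec PZero (PComp p [:: PComp PSucc [:: PProj 0]; PProj 1])) => xs.
elim=> [|x IH]; first by constructor; constructor.
apply: computes_recS IH _; have -> : 'C(x.+2, 2) = x.+1 + 'C(x.+1, 2) by rewrite binS bin1 addnC.
apply: computes_comp2 (cp _ _ _); last exact: (@computes_proj 1).
by apply: computes_comp1 (computes_succ _ _); apply: (@computes_proj 0).
Qed.

Lemma cpair_computable : computable2 cpair.
Proof.
have [p cp] := addn_computable; have [q cq] := triangle_computable.
pose x0 := PProj 0; pose x1 := PProj 1.
exists (PComp p [:: PComp q [:: PComp p [:: x0; x1]]; x1]) => xs x y.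
have c0 : computes x0 [:: x, y & xs] x by apply: (@computes_proj 0).
have c1 : computes x1 [:: x, y & xs] y by apply: (@computes_proj 1).
apply: computes_comp2 (cp _ _ _) => //.
by apply: computes_comp1 (cq _ _); apply: computes_comp2 (cp _ _ _).
Qed.

Lemma computable1_cpair F G :
  computable1 F -> computable1 G -> computable1 (fun x => cpair (F x) (G x)).
Proof.
move=> [p cp] [q cq]; have [r cr] := cpair_computable.
by exists (PComp r [:: p; q]) => xs x; apply: computes_comp2 (cr _ _ _).
Qed.

Lemma computable1_comp F G :
  computable1 F -> computable1 G -> computable1 (F \o G).
Proof.
move=> [p cp] [q cq].
by exists (PComp p [:: q]) => xs x; apply: computes_comp1 (cp _ _).
Qed.

(** One argument is both the number of iterations and the starting point, because the reduction runs
    a formula on its own code as input. *)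
Lemma computable1_iter F : computable1 F -> computable1 (fun x => iter x F x).
Proof.
case=> p cp; pose it := PRec (PProj 0) (PComp p [:: PProj 1]).
have c_it x y : computes it [:: x; y] (iter x F y).
  elim: x => [|x IH]; first by constructor; apply: (@computes_proj 0).
  by apply: computes_recS IH _; apply: computes_comp1 (cp _ _); apply: (@computes_proj 1).
exists (PComp it [:: PProj 0; PProj 0]) => xs x.
by apply: computes_comp2 (c_it _ _); apply: (@computes_proj 0).
Qed.

Local Open Scope fset_scope.

(** * First-order logic of a finite ternary relation *)

Inductive fo : Type :=
| Rel of nat & nat & nat
| Eqv of nat & nat
| Neg of fo
| Conj of fo & fo
| Disj of fo & fo
| Ex of nat & fo.

Section Satisfaction.
Variables (X : Type) (T : X -> X -> X -> Prop).

Definition upd (r : nat -> X) (x : nat) (a : X) : nat -> X :=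
  fun y => if y == x then a else r y.

(** The active domain of the relation: the quantifiers range over it, since these are the atoms that
    an expression can extract from its input set. *)
Definition occurs (a : X) : Prop :=
  exists b c, T a b c \/ T b a c \/ T b c a.

Fixpoint sat (phi : fo) (r : nat -> X) : Prop :=
  match phi with
  | Rel x y z => T (r x) (r y) (r z)
  | Eqv x y => r x = r y
  | Neg phi => ~ sat phi r
  | Conj phi psi => sat phi r /\ sat psi r
  | Disj phi psi => sat phi r \/ sat psi r
  | Ex x phi => exists2 a, occurs a & sat phi (upd r x a)
  end.

Lemma sat_exs vs phi r r' : {in [predC vs], r' =1 r} ->
  (forall x, x \in vs -> occurs (r' x)) -> sat phi r' -> sat (foldr Ex phi vs) r.
Proof.
elim: vs r => [|v vs IH] r r'r occ s /=.
  by rewrite (_ : r = r') //; apply: funext => x; rewrite r'r.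
exists (r' v); first by apply: occ; exact: mem_head.
apply: IH => // x x_vs; last by apply: occ; rewrite inE x_vs orbT.
by rewrite /upd; case: eqVneq => [->|xv] //; apply: r'r; rewrite !inE negb_or xv.
Qed.

Lemma sat_exs_inv vs phi r : sat (foldr Ex phi vs) r ->
  exists2 r', sat phi r' & {in [predC vs], r' =1 r}.
Proof.
elim: vs r => [|v vs IH] r /=; first by exists r.
case=> a _ /IH[r' s eq_r]; exists r' => // x; rewrite !inE negb_or => /andP[xv x_vs].
by rewrite eq_r // /upd (negbTE xv).
Qed.

End Satisfaction.

(** No surjectivity of [h] is required: quantifiers see only occurring elements, and every element
    occurring in [T'] lies in the image of [h]. *)
Lemma sat_transport (X Y : Type) (h : X -> Y) (T : X -> X -> X -> Prop)
    (T' : Y -> Y -> Y -> Prop) :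
  injective h ->
  (forall a b c, T' a b c <-> exists x y z,
     [/\ T x y z, a = h x, b = h y & c = h z]) ->
  forall phi r, sat T' phi (h \o r) <-> sat T phi r.
Proof.
move=> h_inj T'P; have T'h x y z : T' (h x) (h y) (h z) <-> T x y z.
  rewrite T'P; split=> [[x' [y' [z' [Txyz]]]]|Txyz]; last by exists x, y, z.
  by do 3!move/h_inj=> ->.
elim=> [x y z|x y|phi IH|phi IH1 psi IH2|phi IH1 psi IH2|x phi IH] r /=.
- exact: T'h.
- by split=> [/h_inj|->].
- by rewrite IH.
- by rewrite IH1 IH2.
- by rewrite IH1 IH2.
have upd_h a : upd (h \o r) x (h a) = h \o upd r x a.
  by apply: funext => y; rewrite /upd /=; case: eqP.
split=> [[d [b [c occ]] s]|[a [b [c occ]] s]]; last first.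
  exists (h a); last by rewrite upd_h IH.
  by exists (h b), (h c); rewrite !T'h.
by move: occ s; rewrite !T'P => -[|[|]] [x1 [x2 [x3 [Tx ? ? ?]]]]; subst;
  rewrite upd_h IH => s; [exists x1|exists x2|exists x3] => //;
  [exists x2, x3|exists x1, x3|exists x1, x2]; tauto.
Qed.

(** * Compiling first-order formulas to expressions *)

(* Variable 0 holds a set of nodes <a:{<b:{<c>}>}>, the triples of the relation;
   variable 1 holds an atom t different from concat(()); variable 2 is scratch
   space; the first-order variable x becomes x.+3. *)
Definition e_true := EElem (EVar 1) EEmpty.
(** The third atom sits in a data node, on which [name] is undefined. It is turned into an atom by
    making it the name of a new element node. *)
Definition e_universe :=
  EFor 2 (EVar 0)
    (ESeq (EName (EVar 2))
       (ESeq (EName (EChildren (EVar 2)))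
          (EName (EElem (EChildren (EChildren (EVar 2))) EEmpty)))).

(* Truth values are {<t:{}>} and the empty set.  Since name(()) is defined,
   [name] separates them, which yields negation. *)
Fixpoint tr (phi : fo) : expr :=
  match phi with
  | Rel x y z =>
      EFor 2 (EVar 0)
        (EIf (EName (EVar 2)) (EVar x.+3)
           (EIf (EName (EChildren (EVar 2))) (EVar y.+3)
              (EIf (EChildren (EChildren (EVar 2))) (EVar z.+3) e_true EEmpty)
              EEmpty)
           EEmpty)
  | Eqv x y => EIf (EVar x.+3) (EVar y.+3) e_true EEmpty
  | Neg phi => EIf (EName (tr phi)) (EName EEmpty) e_true EEmpty
  | Conj phi psi => EFor 2 (tr phi) (tr psi)
  | Disj phi psi => ESeq (tr phi) (tr psi)
  | Ex x phi => EFor x.+3 e_universe (tr phi)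
  end.

(** If [t] is the name of the empty value, truth values cannot be told apart, and the first branch
    returns the empty value. Otherwise the loop body takes the children of an atom, which is
    undefined, and it is run exactly when [phi] holds. *)
Definition e_fail (phi : fo) : expr :=
  EIf (EVar 1) (EName EEmpty) EEmpty (EFor 2 (tr phi) (EChildren (EVar 1))).

Definition triple_type : ntype := Elem (GSingle (Elem (GSingle Data))).

Definition assignment : {fmap var -> rxtype} :=
  [fmap].[0 <- Coll (INode triple_type)].[1 <- Single IAtom]%fmap.

(** Closedness is read off the translation, which spares a separate notion of free variable for
    formulas. *)
Definition fo_closed (phi : fo) : Prop := forall x, x.+3 \notin FV (tr phi).

Lemma scratch_notin_FV phi : 2 \notin FV (tr phi).
Proof.
elim: phi => [x y z|x y|phi IH|phi IH1 psi IH2|phi IH1 psi IH2|x phi IH] /=;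
  by rewrite !inE //= ?(negbTE IH) ?(negbTE IH1) ?(negbTE IH2) ?andbF.
Qed.

(** A leading quantifier guarantees an occurrence of variable 0, through [e_universe]; variable 1
    occurs in the first test of [e_fail]. *)
Lemma FV_e_fail x phi : fo_closed (Ex x phi) -> FV (e_fail (Ex x phi)) = domf assignment.
Proof.
set psi := Ex x phi => psi_closed; have psi_0 : 0 \in FV (tr psi) by rewrite !inE.
have psi_2 := scratch_notin_FV psi; clearbody psi.
apply/fsetP => v; rewrite /e_fail [FV _]/= !inE.
by case: v => [|[|[|v]]]; rewrite ?psi_0 ?(negbTE psi_2) ?(negbTE (psi_closed v)) //.
Qed.

(** * Evaluation of translated formulas *)

Section Compile.
Variable A : set nat.
Variable content : atom A -> {fset node A} -> atom A.
Variable concat : {fset atom A} -> atom A.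
Local Notation eval := (eval content concat).

Definition triple (a b c : atom A) : item A :=
  inr (enode a [fset enode b [fset dnode c]]).

Lemma in_triple_type i : in_itype (INode triple_type) i <-> exists a b c, i = triple a b c.
Proof.
split=> [[n [-> [a [N [-> [m [-> [b [M [-> [k [-> [c ->]]]]]]]]]]]]]|[a [b [c ->]]]].
  by exists a, b, c.
exists (enode a [fset enode b [fset dnode c]]); split=> //.
exists a, [fset enode b [fset dnode c]]; split=> //.
exists (enode b [fset dnode c]); split=> //; exists b, [fset dnode c]; split=> //.
by exists (dnode c); split=> //; exists c.
Qed.

Lemma enode_inj a b N M : @enode A a N = enode b M -> a = b /\ N = M.
Proof. by move/(congr1 (@Defs.shape A)); rewrite !(unshapeK (ElemNode _ _)) => -[-> ->]. Qed.

Lemma triple_inj a b c a' b' c' :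
  triple a b c = triple a' b' c' -> [/\ a = a', b = b' & c = c'].
Proof.
have node_inj (n m : node A) : inr n = inr m :> item A -> n = m by case.
have dnode_inj (x y : atom A) : dnode x = dnode y -> x = y by case.
by move=> /node_inj/enode_inj[-> /fset1_inj/enode_inj[-> /fset1_inj/dnode_inj ->]].
Qed.

Lemma imfset_fset1 (K L : choiceType) (f : K -> L) x : [fset f y | y in [fset x]] = [fset f x].
Proof.
apply/fsetP => y; rewrite !inE; apply/imfsetP/eqP => [[z]|->]; last by exists x; rewrite ?inE.
by rewrite inE => /eqP ->.
Qed.

Lemma imfset_fset0 (K L : choiceType) (f : K -> L) : [fset f y | y in fset0] = fset0.
Proof. by apply/fsetP => y; rewrite !inE; apply/imfsetP => -[z]; rewrite inE. Qed.

Local Opaque enode.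

Lemma data_fset1 i : data content [fset i] = [fset data_item content i].
Proof. exact: imfset_fset1. Qed.

Lemma the_atom_fset1 (a : atom A) : the_atom [fset a] = Some a.
Proof. by apply/the_atomP. Qed.

Lemma children_enode a N : children [fset inr (@enode A a N)] = Some [fset inr m | m in N].
Proof.
by rewrite /children -fset_seq1 big_seq1 /children_item (unshapeK (ElemNode a N)).
Qed.

Lemma construct_fset0 i : construct content [fset i] fset0 = Some (enode (data_item content i) fset0).
Proof. by rewrite /construct data_fset1 the_atom_fset1 /= imfset_fset0. Qed.

Lemma eval_EIf e1 e2 e3 e4 s i1 i2 :
  eval e1 s = Some [fset i1] -> eval e2 s = Some [fset i2] ->
  eval (EIf e1 e2 e3 e4) s =
    eval (if data_item content i1 == data_item content i2 then e3 else e4) s.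
Proof. by move=> /= -> ->; rewrite /= !data_fset1 !the_atom_fset1; case: ifP. Qed.

(** Values are specified by a membership predicate in [Prop], because satisfaction is not given as a
    boolean; definedness is included. *)
Definition evals (e : expr) (s : {fmap var -> value A}) (P : item A -> Prop) : Prop :=
  exists2 w, eval e s = Some w & forall j, j \in w <-> P j.

Lemma evals_ext e s P Q : (forall j, P j <-> Q j) -> evals e s P -> evals e s Q.
Proof. by move=> PQ [w ew wP]; exists w => // j; rewrite wP. Qed.

Lemma evals_fset1 e s i : eval e s = Some [fset i] <-> evals e s (eq^~ i).
Proof.
split=> [e_i|[w -> wP]]; first by exists [fset i] => // j; rewrite inE; split=> /eqP.
by congr Some; apply/fsetP => j; rewrite inE; apply/idP/eqP => /wP.
Qed.

Lemma evals_fset0 e s : eval e s = Some fset0 <-> evals e s (fun=> False).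
Proof.
split=> [e_0|[w -> wP]]; first by exists fset0 => // j; rewrite inE.
by congr Some; apply/fsetP => j; rewrite inE; apply/idP => /wP.
Qed.

Lemma evals_ESeq e1 e2 s P Q : evals e1 s P -> evals e2 s Q ->
  evals (ESeq e1 e2) s (fun j => P j \/ Q j).
Proof.
move=> [v ev vP] [w ew wQ]; exists (v `|` w); first by rewrite /= ev ew.
by move=> j; rewrite inE -vP -wQ; split=> [/orP|/orP].
Qed.

Lemma evals_EFor x e1 e2 s (P : item A -> Prop) (Q : item A -> item A -> Prop) :
  evals e1 s P -> (forall i, P i -> evals e2 s.[x <- [fset i]]%fmap (Q i)) ->
  evals (EFor x e1 e2) s (fun j => exists2 i, P i & Q i j).
Proof.
move=> [v ev vP] e2Q; rewrite /evals /= ev all_map big_map.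
have e2v i : i \in v -> evals e2 s.[x <- [fset i]]%fmap (Q i) by move/vP/e2Q.
rewrite ifT; last by apply/allP => i /e2v[w /= ->].
exists (\bigcup_(i <- enum_fset v) odflt fset0 (eval e2 s.[x <- [fset i]]%fmap)) => // j.
split=> [/bigfcupP[i /andP[iv _]]|[i /vP iv]].
  by have [w -> wQ /wQ] := e2v _ iv; exists i => //; apply/vP.
by have [w ew wQ /wQ jw] := e2v _ iv; apply/bigfcupP; exists i; rewrite ?iv // ew.
Qed.

Lemma eval_EFor_undefined x e1 e2 s v i :
  eval e1 s = Some v -> i \in v -> eval e2 s.[x <- [fset i]]%fmap = None ->
  eval (EFor x e1 e2) s = None.
Proof.
move=> /= -> iv ev2; rewrite ifN // all_map; apply/allPn; exists i => //.
by rewrite /= ev2.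
Qed.

Section Triples.
Variables (W : value A) (t : atom A).
Hypothesis W_triples : forall i, i \in W -> in_itype (INode triple_type) i.
Hypothesis t_neq : t != concat fset0.

Definition rel_of (a b c : atom A) : Prop := triple a b c \in W.

Definition true_item : item A := inr (enode t fset0).

Definition env_base (s : {fmap var -> value A}) : Prop :=
  s.[? 0]%fmap = Some W /\ s.[? 1]%fmap = Some [fset inl t].

Lemma evals_true s : env_base s -> evals e_true s (eq^~ true_item).
Proof. by case=> s0 s1; apply/evals_fset1; rewrite /= s1 construct_fset0. Qed.

Lemma evals_triples s : env_base s ->
  evals (EVar 0) s (fun i => exists a b c, rel_of a b c /\ i = triple a b c).
Proof.
case=> s0 _; exists W => // i; split=> [iW|[a [b [c [abc ->]]]] //].
by have /in_triple_type[a [b [c ei]]] := W_triples iW; exists a, b, c; rewrite /rel_of -ei.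
Qed.

Section Parts.
Variables (s : {fmap var -> value A}) (a b c : atom A).
Hypothesis s2 : s.[? 2]%fmap = Some [fset triple a b c].

Lemma eval_name1 : eval (EName (EVar 2)) s = Some [fset inl a].
Proof. by rewrite /= s2 /obind /oapp /triple name_enode. Qed.

Lemma eval_children1 :
  eval (EChildren (EVar 2)) s = Some [fset inr (enode b [fset dnode c])].
Proof. rewrite /= s2 /obind /oapp /triple children_enode imfset_fset1; reflexivity. Qed.

Lemma eval_name2 : eval (EName (EChildren (EVar 2))) s = Some [fset inl b].
Proof.
have := eval_children1; rewrite /= => ->; exact: name_enode.
Qed.

Lemma eval_children2 :
  eval (EChildren (EChildren (EVar 2))) s = Some [fset inr (dnode c)].
Proof.
have := eval_children1; rewrite /= => ->.
by rewrite [obind _ _]children_enode imfset_fset1.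
Qed.

Lemma eval_name3 :
  eval (EName (EElem (EChildren (EChildren (EVar 2))) EEmpty)) s = Some [fset inl c].
Proof.
have := eval_children2; rewrite /= => ->.
rewrite construct_fset0; exact: name_enode.
Qed.

End Parts.

Lemma evals_universe s : env_base s ->
  evals e_universe s (fun i => exists2 a, occurs rel_of a & i = inl a).
Proof.
move=> s_base; apply: evals_ext (evals_EFor (evals_triples s_base)
  (Q := fun i j => exists a b c, i = triple a b c /\ (j = inl a \/ (j = inl b \/ j = inl c))) _).
  move=> j; split=> [[_ [a [b [c [abc ->]]]] [_ [_ [_ [/triple_inj[<- <- <-]]]]]]|].
    case=> [->|[|]->]; [exists a|exists b|exists c] => //; [exists b, c|exists a, c|exists a, b].
    - by left.
    - by right; left.
    - by right; right.
  case=> d [b [c occ]] ->; case: occ => [Td|[Td|Td]].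
  - by exists (triple d b c); exists d, b, c; split=> //; left.
  - by exists (triple b d c); exists b, d, c; split=> //; right; left.
  - by exists (triple b c d); exists b, c, d; split=> //; right; right.
move=> _ [a [b [c [_ ->]]]]; set s' := s.[_ <- _]%fmap.
have s2 : s'.[? 2]%fmap = Some [fset triple a b c] by rewrite fnd_set eqxx.
apply: evals_ext (evals_ESeq (proj1 (evals_fset1 _ _ _) (eval_name1 s2))
   (evals_ESeq (proj1 (evals_fset1 _ _ _) (eval_name2 s2))
   (proj1 (evals_fset1 _ _ _) (eval_name3 s2)))) => j.
by split=> [j_abc|[_ [_ [_ [/triple_inj[<- <- <-]]]]] //]; exists a, b, c.
Qed.

Definition env_for (r : nat -> atom A) phi s : Prop :=
  env_base s /\ forall x, x.+3 \in FV (tr phi) -> s.[? x.+3]%fmap = Some [fset inl (r x)].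

Lemma env_base_set s x v : 1 < x -> env_base s -> env_base s.[x <- v]%fmap.
Proof. by case: x => [|[|x]] // _ [s0 s1]; rewrite /env_base !fnd_set. Qed.

(** A truth value has at most one element, so a loop over it is a conditional, which gives
    conjunction; union gives disjunction, and a loop over the universe is a union of truth values,
    hence an existential quantifier. Definedness is part of the induction, since an undefined
    subexpression would spoil every context. *)
Lemma evals_tr phi s r : env_for r phi s ->
  evals (tr phi) s (fun j => sat rel_of phi r /\ j = true_item).
Proof.
have if_true (b : bool) (P : Prop) u : env_base u -> (b <-> P) ->
    evals (if b then e_true else EEmpty) u (fun j => P /\ j = true_item).
  case: b => u_b bP.
    apply: evals_ext (evals_true u_b) => j.
    by split=> [->|[_ ->]] //; split=> //; apply/bP.
  by apply: evals_ext (proj1 (evals_fset0 _ _) _) => // j; split=> // -[/bP].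
elim: phi s r => [x y z|x y|phi IH|phi IH1 psi IH2|phi IH1 psi IH2|x phi IH] s r [s_b s_r].
- apply: evals_ext (evals_EFor (evals_triples s_b) (Q := fun i j =>
    triple (r x) (r y) (r z) = i /\ j = true_item) _).
    move=> j; split=> [[_ [a [b [c [abc ->]]]] [/triple_inj[? ? ?] ->]]|[xyz ->]]; first by subst.
    by exists (triple (r x) (r y) (r z)) => //; exists (r x), (r y), (r z).
  move=> _ [a [b [c [_ ->]]]]; set s' := s.[_ <- _]%fmap.
  have s2 : s'.[? 2]%fmap = Some [fset triple a b c] by rewrite fnd_set eqxx.
  have s'v v : v.+3 \in FV (tr (Rel x y z)) -> eval (EVar v.+3) s' = Some [fset inl (r v)].
    by move=> /s_r; rewrite /= fnd_set.
  have [s'x s'y s'z] : [/\ eval (EVar x.+3) s' = Some [fset inl (r x)],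
      eval (EVar y.+3) s' = Some [fset inl (r y)] &
      eval (EVar z.+3) s' = Some [fset inl (r z)]].
    by split; apply: s'v; rewrite !inE eqxx !orbT.
  have abcP : [&& a == r x, b == r y & c == r z] <-> triple (r x) (r y) (r z) = triple a b c.
    split=> [/and3P[/eqP-> /eqP-> /eqP->] //|/triple_inj[-> -> ->]].
    by rewrite !eqxx.
  (* The nested conditionals of [tr] evaluate this conjunction one coordinate at a time. *)
  have : evals (if [&& a == r x, b == r y & c == r z] then e_true else EEmpty) s'
      (fun j => triple (r x) (r y) (r z) = triple a b c /\ j = true_item).
    by apply: if_true abcP; exact: env_base_set.
  rewrite /evals (eval_EIf _ _ (eval_name1 s2) s'x) [data_item _ _]/=.
  case: (a == r x) => [|//]; rewrite [if true then EIf _ _ _ _ else _]/= andTb.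
  rewrite (eval_EIf _ _ (eval_name2 s2) s'y) [data_item _ _]/=.
  case: (b == r y) => [|//]; rewrite [if true then EIf _ _ _ _ else _]/= andTb.
  by rewrite (eval_EIf _ _ (eval_children2 s2) s'z) [data_item _ _]/=.
- rewrite /evals [tr _]/= (@eval_EIf _ _ _ _ _ (inl (r x)) (inl (r y))) /=; last 2 first.
  + by apply: s_r; rewrite !inE eqxx.
  + by apply: s_r; rewrite !inE eqxx orbT.
  by apply: if_true => //; split=> /eqP.
- have s_phi : env_for r phi s.
    by split=> // x x_phi; apply: s_r; rewrite !inE x_phi.
  have [w ew wP] := IH _ _ s_phi.
  have e_empty : eval (EName EEmpty) s = Some [fset inl (concat fset0)] by exact: name0.
  (* The name of the true value is [t], that of the empty value is [concat fset0]; the hypothesis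
     [t_neq] keeps them apart. *)
  have [sat_phi|nsat_phi] := pselect (sat rel_of phi r).
    have e_phi : eval (EName (tr phi)) s = Some [fset inl t].
      have w_true : w = [fset true_item].
        by apply/fsetP => j; rewrite inE; apply/idP/eqP => [/wP[]//|->]; apply/wP.
      by rewrite /= ew w_true [obind _ _]name_enode.
    rewrite /evals [tr _]/= (eval_EIf _ _ e_phi e_empty) /=; apply: if_true => //.
    by rewrite (negbTE t_neq).
  have e_phi : eval (EName (tr phi)) s = Some [fset inl (concat fset0)].
    have w_false : w = fset0.
      by apply/fsetP => j; rewrite inE; apply/idP => /wP[].
    by rewrite /= ew w_false [obind _ _]name0.
  by rewrite /evals [tr _]/= (eval_EIf _ _ e_phi e_empty) /=; apply: if_true => //; rewrite eqxx.
- have s_phi : env_for r phi s.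
    by split=> // x x_phi; apply: s_r; rewrite !inE x_phi.
  apply: evals_ext (evals_EFor (IH1 _ _ s_phi) (Q := fun i j => sat rel_of psi r /\ j = true_item) _).
    move=> j; split=> [[_ [? _] [? ->]]|[[? ?] ->]] //.
    by exists true_item.
  move=> i _; apply: IH2; split; first exact: env_base_set.
  by move=> x x_psi; rewrite fnd_set /=; apply: s_r; rewrite !inE x_psi orbT.
- have s_phi : env_for r phi s.
    by split=> // x x_phi; apply: s_r; rewrite !inE x_phi.
  have s_psi : env_for r psi s.
    by split=> // x x_psi; apply: s_r; rewrite !inE x_psi orbT.
  by apply: evals_ext (evals_ESeq (IH1 _ _ s_phi) (IH2 _ _ s_psi)) => j /=; tauto.
- apply: evals_ext (evals_EFor (evals_universe s_b) (Q := fun i j =>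
    exists a, i = inl a /\ sat rel_of phi (upd r x a) /\ j = true_item) _).
    move=> j; split=> [[_ [a a_occ ->] [_ [[<-] [? ->]]]]|[[a a_occ ?] ->]].
      by split=> //; exists a.
    by exists (inl a); exists a.
  move=> _ [a _ ->]; apply: evals_ext (IH _ (upd r x a) _).
    by move=> j; split=> [?|[_ [[<-]]]] //; exists a.
  split; first exact: env_base_set.
  move=> y y_phi; rewrite fnd_set /upd !eqSS; case: eqP => // /eqP yx.
  by apply: s_r; rewrite !inE y_phi !eqSS yx.
Qed.

Lemma eval_e_fail phi s r : fo_closed phi -> env_base s ->
  (exists v, eval (e_fail phi) s = Some v) <-> ~ sat rel_of phi r.
Proof.
move=> phi_closed s_base; have [s0 s1] := s_base.
have [w ew wP] : evals (tr phi) s (fun j => sat rel_of phi r /\ j = true_item).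
  by apply: evals_tr; split=> // x; rewrite (negbTE (phi_closed x)).
have e_empty : eval (EName EEmpty) s = Some [fset inl (concat fset0)] by exact: name0.
have -> : eval (e_fail phi) s = eval (EFor 2 (tr phi) (EChildren (EVar 1))) s.
  by rewrite /e_fail (eval_EIf _ _ (s1 : eval (EVar 1) s = _) e_empty) /= (negbTE t_neq).
split=> [[v ev] sat_phi|nsat_phi].
  have jw : true_item \in w by apply/wP.
  rewrite (eval_EFor_undefined ew jw) // in ev.
  by rewrite /= fnd_set s1 /= /children -fset_seq1.
exists fset0; apply/evals_fset0.
have ev_phi : evals (tr phi) s (fun j => sat rel_of phi r /\ j = true_item) by exists w.
apply: evals_ext (evals_EFor ev_phi (Q := fun _ _ => False) _); last by move=> i [].
by move=> j; split=> // -[].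
Qed.

End Triples.

(** An environment for [assignment] is a choice of [W] and [t]. Those with [t] equal to
    [concat fset0] never cause failure, so they can be left out on the right. *)
Lemma well_defined_e_fail phi : fo_closed phi ->
  well_defined content concat (e_fail phi) assignment <->
  forall (W : value A) t r, (forall i, i \in W -> in_itype (INode triple_type) i) ->
    t != concat fset0 -> ~ sat (rel_of W) phi r.
Proof.
move=> phi_closed; split=> [wd W t r W_ok t_neq|nsat s [s_dom s_ok]].
  pose s := [fmap].[0 <- W].[1 <- [fset inl t]]%fmap.
  have s_base : env_base W t s by rewrite /env_base /s !fnd_set.
  have [nsat _] := eval_e_fail W_ok t_neq r phi_closed s_base; apply: nsat; apply: wd; split.
    by rewrite /s /assignment; apply/fsetP => x; rewrite !inE.
  move=> x v u; rewrite /s /assignment !fnd_set.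
  case: (x == 1) => [[<-] [<-]|]; first by exists (inl t); split=> //; exists t.
  by case: (x == 0) => [[<-] [<-]|]; rewrite ?fnd_fmap0.
have in_s x : x \in domf assignment -> exists v, s.[? x]%fmap = Some v.
  by rewrite -s_dom; case: fndP => // xs _; exists s.[xs]%fmap.
have [W s0] : exists v, s.[? 0]%fmap = Some v by apply: in_s; rewrite !inE.
have [v s1] : exists v, s.[? 1]%fmap = Some v by apply: in_s; rewrite !inE.
have W_ok : forall i, i \in W -> in_itype (INode triple_type) i.
  by apply: (s_ok _ _ (Coll (INode triple_type)) s0); rewrite !fnd_set.
have [|i [ev [t ei]]] := s_ok _ _ (Single IAtom) s1; first by rewrite fnd_set.
have {s1}s1 : s.[? 1]%fmap = Some [fset inl t] by rewrite s1 ev ei.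
have [t_eq|t_neq] := eqVneq t (concat fset0).
  have e_empty : eval (EName EEmpty) s = Some [fset inl (concat fset0)] by exact: name0.
  by exists fset0; rewrite /e_fail (eval_EIf _ _ (s1 : eval (EVar 1) s = _) e_empty) /= t_eq eqxx.
have [_ ok] := eval_e_fail W_ok t_neq (fun=> t) phi_closed (conj s0 s1).
exact: ok (nsat W t _ W_ok t_neq).
Qed.

End Compile.

(** * Formulas describing computations *)

Lemma prf_nested_ind (P : prf -> Prop) :
  P PZero -> P PSucc -> (forall i, P (PProj i)) ->
  (forall f gs, P f -> (forall i, i < size gs -> P (nth PZero gs i)) -> P (PComp f gs)) ->
  (forall f g, P f -> P g -> P (PRec f g)) ->
  (forall f, P f -> P (PMu f)) ->
  forall f, P f.
Proof.
move=> P0 PS PP PC PR PM; fix IH 1; case=> [||i|f gs|f g|f].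
- exact: P0.
- exact: PS.
- exact: PP.
- apply: (PC f gs (IH f)).
  elim: gs => [|g gs IHgs] [|i] lt_i; [discriminate lt_i|discriminate lt_i|exact: IH|exact: IHgs].
- exact: PR (IH f) (IH g).
- exact: PM (IH f).
Qed.

Fixpoint code_prf (f : prf) : nat :=
  match f with
  | PZero => cpair 0 0
  | PSucc => cpair 1 0
  | PProj i => cpair 2 i
  | PComp f gs => cpair 3 (cpair (code_prf f) (code_seq (map code_prf gs)))
  | PRec f g => cpair 4 (cpair (code_prf f) (code_prf g))
  | PMu f => cpair 5 (code_prf f)
  end.

Lemma code_prf_inj : injective code_prf.
Proof.
elim/prf_nested_ind=> [||i|f gs IHf IHgs|f g IHf IHg|f IHf] [||i'|f' gs'|f' g'|f'] /cpair_inj[] //.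
- by move=> _ ->.
- move=> _ /cpair_inj[/IHf -> /code_seq_inj eq_gs]; congr PComp.
  elim: gs gs' IHgs eq_gs => [|g gs IH] [|g' gs'] //= IHgs [eq_g eq_gs].
  congr cons; first exact: (IHgs 0 isT _ eq_g).
  by apply: IH => // i; apply: (IHgs i.+1).
- by move=> _ /cpair_inj[/IHf -> /IHg ->].
- by move=> _ /IHf ->.
Qed.

(* In a structure, the number n is an element from which the attribute TL leads
   to ZERO in n steps, and a list is ZERO or an element l with a head and a tail;
   a triple (l, attr f, y) claims that f maps l to y, and (l, sattr f, y) with
   l = m :: xs that y is the least zero of f (_, xs) from m on. *)
Local Notation ZERO := 0 (only parsing).
Local Notation TL := 1 (only parsing).
Local Notation INPUT := 2 (only parsing).
Local Notation HD := 3 (only parsing).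
Local Notation vL := 4 (only parsing).
Local Notation vY := 5 (only parsing).
Local Notation vA := 6 (only parsing).
Local Notation vB := 7 (only parsing).
Local Notation vM := 8 (only parsing).
Local Notation vN := 9 (only parsing).
Local Notation vR := 10 (only parsing).
Local Notation vP := 11 (only parsing).
Local Notation vQ := 12 (only parsing).
Local Notation MARK := 13 (only parsing).

(** Attributes of values are even and attributes of searches odd, and both start at 16, beyond all
    the fixed variables. *)
Definition attr (f : prf) : nat := ((code_prf f).*2).+4.+4.+4.+4.
Definition sattr (f : prf) : nat := ((code_prf f).*2.+1).+4.+4.+4.+4.

Definition is_pair l a m := Conj (Rel l HD a) (Rel l TL m).

(** Each step rebinds [vL] to the tail, passing it through [vM], so that the same few variables
    serve for all [i]. *)
Fixpoint proj_fo i :=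
  if i is i'.+1 then Ex vM (Conj (Rel vL TL vM) (Ex vL (Conj (Eqv vL vM) (proj_fo i'))))
  else Ex vM (is_pair vL vY vM).

(* vM is the list of the values of gs on vL. *)
Fixpoint args_fo gs :=
  if gs is g :: gs' then
    Ex vB (Ex vN (Conj (is_pair vM vB vN) (Conj (Rel vL (attr g) vB)
      (Ex vM (Conj (Eqv vM vN) (args_fo gs'))))))
  else Eqv vM ZERO.

(** The clauses of [computes] read backwards: the triples that must back a claimed value. No
    negation is used, so a justification survives when the structure grows. *)
Definition step_fo f :=
  match f with
  | PZero => Eqv vY ZERO
  | PSucc => Ex vA (Ex vM (Conj (is_pair vL vA vM) (Rel vY TL vA)))
  | PProj i => proj_fo i
  | PComp g hs => Ex vM (Conj (args_fo hs) (Rel vM (attr g) vY))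
  | PRec g h =>
      Ex vA (Ex vM (Conj (is_pair vL vA vM)
        (Disj (Conj (Eqv vA ZERO) (Rel vM (attr g) vY))
           (Ex vB (Conj (Rel vA TL vB) (Ex vN (Conj (is_pair vN vB vM)
             (Ex vR (Conj (Rel vN (attr f) vR) (Ex vP (Conj (is_pair vP vR vM)
               (Ex vQ (Conj (is_pair vQ vB vP) (Rel vQ (attr h) vY))))))))))))))
  | PMu g => Ex vN (Conj (is_pair vN ZERO vL) (Rel vN (sattr g) vY))
  end.

(** Minimization without a universal quantifier over the smaller candidates: either the current
    candidate [vA] is a zero and the answer, or the value there has a predecessor and the search
    from the next candidate claims the same answer. *)
Definition search_fo f :=
  Ex vA (Ex vM (Conj (is_pair vL vA vM) (Ex vB (Conj (Rel vL (attr f) vB)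
    (Disj (Conj (Eqv vB ZERO) (Eqv vY vA))
       (Ex vN (Conj (Rel vB TL vN) (Ex vP (Conj (Rel vP TL vA)
         (Ex vQ (Conj (is_pair vQ vP vM) (Rel vQ (sattr f) vY)))))))))))).

Definition check v phi := Neg (Ex vL (Ex vY (Conj (Rel vL v vY) (Neg phi)))).

Fixpoint checks f :=
  Conj (check (attr f) (step_fo f))
    match f with
    | PComp g hs => Conj (checks g) (foldr (fun h => Conj (checks h)) (Eqv 0 0) hs)
    | PRec g h => Conj (checks g) (checks h)
    | PMu g => Conj (check (sattr g) (search_fo g)) (checks g)
    | _ => Eqv 0 0
    end.

(** Zero has no tail, and a triple is determined by its first two components. No successors are
    postulated, as this would exclude finite models; the numbers and lists that a rule needs are
    among its witnesses. *)
Definition axioms_fo :=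
  Conj (Neg (Ex vA (Rel ZERO TL vA)))
    (Neg (Ex vL (Ex vY (Ex vA (Ex vB
      (Conj (Rel vL vY vA) (Conj (Rel vL vY vB) (Neg (Eqv vA vB))))))))).

Definition halts_fo f :=
  Conj axioms_fo (Conj (checks f)
    (Ex vL (Ex vY (Conj (is_pair vL INPUT ZERO) (Rel vL (attr f) vY))))).

(** * Soundness: claims in finite models are true *)

Section Soundness.
Variables (X : eqType) (T : X -> X -> X -> Prop) (dom : seq X) (r0 : nat -> X).
Hypothesis occurs_dom : forall a, occurs T a -> a \in dom.
Hypothesis axioms_r0 : sat T axioms_fo r0.

Lemma occurs3 a b c : T a b c -> [/\ occurs T a, occurs T b & occurs T c].
Proof.
move=> Tabc; split; [exists b, c|exists a, c|exists a, b].
- by left.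
- by right; left.
- by right; right.
Qed.

Lemma T_fun l y a b : T l y a -> T l y b -> a = b.
Proof.
move=> Ta Tb; apply: contrapT => ab; have [_] := axioms_r0; apply.
have [ol oy oa] := occurs3 Ta; have [_ _ ob] := occurs3 Tb.
by exists l => //; exists y => //; exists a => //; exists b.
Qed.

Lemma zero_no_tl a : ~ T (r0 ZERO) (r0 TL) a.
Proof.
by move=> Ta; have [+ _] := axioms_r0; apply; exists a => //; case: (occurs3 Ta).
Qed.

Lemma check_sat v phi l y : v != vL -> v != vY ->
  sat T (check v phi) r0 -> T l (r0 v) y -> sat T phi (upd (upd r0 vL l) vY y).
Proof.
move=> vL vY chk Ty; apply: contrapT => nphi; apply: chk.
have [ol _ oy] := occurs3 Ty; exists l => //; exists y => //; split=> //=.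
by rewrite /upd /= (negbTE vL) (negbTE vY).
Qed.

Fixpoint rep (n : nat) (a : X) : Prop :=
  if n is n'.+1 then exists2 b, T a (r0 TL) b & rep n' b else a = r0 ZERO.

Fixpoint rep_list (xs : seq nat) (l : X) : Prop :=
  if xs is x :: xs' then
    exists a m, [/\ T l (r0 HD) a, T l (r0 TL) m, rep x a & rep_list xs' m]
  else l = r0 ZERO.

Lemma rep_fun n m a : rep n a -> rep m a -> n = m.
Proof.
elim: n m a => [|n IH] [|m] a //=.
- by move=> -> [b /zero_no_tl].
- by move=> [b Tb _] a0; move: Tb; rewrite a0 => /zero_no_tl.
- by move=> [b Tb nb] [c Tc mc]; rewrite (T_fun Tc Tb) in mc; rewrite (IH m b).
Qed.

(** The elements on the chain of tails from [a], zero not counted, represent different numbers, so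
    they are [n] distinct elements of [dom]. This bound makes searches in a finite model end. *)
Lemma rep_bound n a : rep n a -> n <= size dom.
Proof.
move=> na; suff [s [uniq_s sz_s s_dom _]] : exists s, [/\ uniq s, size s = n,
    {subset s <= dom} & forall x, x \in s -> exists2 k, k <= n & rep k x].
  by rewrite -sz_s; apply: uniq_leq_size.
elim: n a na => [|n IH] a /=; first by exists [::].
case=> b Tb nb; have [s [uniq_s sz_s s_dom s_rep]] := IH _ nb.
have na : rep n.+1 a by exists b.
exists (a :: s); split=> /=.
- rewrite uniq_s andbT; apply/negP => /s_rep[k le_kn ka].
  by move: le_kn; rewrite (rep_fun ka na) ltnn.
- by rewrite sz_s.
- move=> x; rewrite inE => /predU1P[->|/s_dom //].
  by apply: occurs_dom; case: (occurs3 Tb).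
- move=> x; rewrite inE => /predU1P[->|/s_rep[k le_kn kx]]; first by exists n.+1.
  by exists k => //; apply: leqW.
Qed.

Lemma rep_list_cons xs l a m : rep_list xs l -> T l (r0 HD) a -> T l (r0 TL) m ->
  exists x ys, [/\ xs = x :: ys, rep x a & rep_list ys m].
Proof.
case: xs => [|x ys] /=; first by move=> -> _ /zero_no_tl.
by move=> [a' [m' [/T_fun Ta /T_fun Tm xa ym]]] /Ta <- /Tm <-; exists x, ys.
Qed.

Lemma proj_sound i xs r : r TL = r0 TL -> r HD = r0 HD ->
  rep_list xs (r vL) -> sat T (proj_fo i) r -> i < size xs /\ rep (nth 0 xs i) (r vY).
Proof.
elim: i xs r => [|i IH] xs r rTL rHD /= xs_L.
  by case=> m _; rewrite /upd /= rTL rHD => -[TY Tm]; have [x [ys [-> xa _]]] := rep_list_cons xs_L TY Tm.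
case=> m _; rewrite /upd /= -/upd => -[Tm [l _ [eq_lm sat_i]]].
rewrite {}eq_lm in sat_i; rewrite rTL in Tm.
case: xs xs_L => [/= L0|x ys /= [a [m' [_ Tm' _ ys_m']]]].
  by move: Tm; rewrite L0 => /zero_no_tl.
rewrite (T_fun Tm' Tm) in ys_m'; rewrite ltnS.
by apply: (IH ys _ _ _ _ sat_i).
Qed.

Definition sound f := forall xs l y, rep_list xs l -> T l (r0 (attr f)) y ->
  exists2 n, rep n y & computes f xs n.

Lemma args_sound gs xs r : r TL = r0 TL -> r HD = r0 HD -> r ZERO = r0 ZERO ->
  (forall g, r (attr g) = r0 (attr g)) ->
  (forall i, i < size gs -> sound (nth PZero gs i)) ->
  rep_list xs (r vL) -> sat T (args_fo gs) r ->
  exists ys, [/\ size ys = size gs, rep_list ys (r vM) &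
    forall i, i < size gs -> computes (nth PZero gs i) xs (nth 0 ys i)].
Proof.
elim: gs r => [|g gs IH] r rTL rHD rZ rT gs_sound xs_L /=.
  by rewrite rZ => ->; exists [::].
case=> b _ [n _]; rewrite /upd /= -/(attr g) -/upd rTL rHD rT => -[[Tb Tn] [Tg [m _ [eq_mn sat_gs]]]].
rewrite {}eq_mn in sat_gs.
have [|ys [sz_ys ys_n ys_gs]] := IH (upd (upd (upd r vB b) vN n) vM n) rTL rHD rZ rT _ xs_L sat_gs.
  by move=> i; apply: (gs_sound i.+1).
have [y y_b gy] := gs_sound 0 isT _ _ _ xs_L Tg.
exists (y :: ys); split=> [|/=|[|i] lt_i] //=; first by rewrite sz_ys.
- by exists b, n.
- exact: ys_gs.
Qed.

(** Induction on the program. Only recursion and minimization refer back to claims about the program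
    itself; they need inner inductions. *)
Lemma checks_sound f : sat T (checks f) r0 -> sound f.
Proof.
have step_ok g : sat T (check (attr g) (step_fo g)) r0 -> forall l y,
    T l (r0 (attr g)) y -> sat T (step_fo g) (upd (upd r0 vL l) vY y).
  by move=> chk l y; apply: check_sat.
elim/prf_nested_ind: f => [||i|f gs IHf IHgs|f g IHf IHg|f IHf] [/step_ok chk] chks xs l y xs_l Tl;
  have sat_step := chk _ _ Tl.
- by exists 0 => //; constructor.
- case: sat_step => a _ [m _] /= [[Ta Tm] Ty].
  have [x [ys [-> xa ym]]] := rep_list_cons xs_l (Ta : T l (r0 HD) a) (Tm : T l (r0 TL) m).
  by exists x.+1; [exists a|constructor].
- have [lt_i rep_i] := @proj_sound i xs (upd (upd r0 vL l) vY y) erefl erefl xs_l sat_step.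
  by exists (nth 0 xs i) => //; constructor.
- case: sat_step => m _ [sat_gs Tm]; case: chks => /IHf f_sound gs_checks.
  have gs_sound i : i < size gs -> sound (nth PZero gs i).
    move=> lt_i; apply: IHgs => //; elim: gs gs_checks i lt_i {chk sat_gs Tl} => [|g gs IH] //=.
    by case=> g_checks gs_checks [|i] //; apply: IH.
  have [ys [sz_ys ys_m c_ys]] :=
    @args_sound gs xs (upd (upd (upd r0 vL l) vY y) vM m)
      erefl erefl erefl (fun=> erefl) gs_sound xs_l sat_gs.
  have [n ny fn] := f_sound _ _ _ ys_m Tm.
  by exists n => //; apply: computes_comp fn.
- case: chks => /IHf f_sound /IHg g_sound.
  (* Inner induction on the recursion argument, with the list and the value generalized. *)
  suff rec_sound x zs l' y' : rep_list (x :: zs) l' -> T l' (r0 (attr (PRec f g))) y' ->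
      exists2 n, rep n y' & computes (PRec f g) (x :: zs) n.
    case: sat_step => a _ [m _] [[Ta Tm] _].
    have [x [zs [exs _ _]]] := rep_list_cons xs_l (Ta : T l (r0 HD) a) (Tm : T l (r0 TL) m).
    by rewrite exs in xs_l *; apply: rec_sound xs_l Tl.
  elim: x l' y' {xs l y xs_l sat_step Tl} => [|x IHx] l y xs_l /chk[a _ [m _] [[Ta Tm]]];
    have [_ [_ [[<- <-] x_a zs_m]]] := rep_list_cons xs_l (Ta : T l (r0 HD) a) (Tm : T l (r0 TL) m)
      => sat_step.
    case: sat_step => [[_ Tf]|[b _ [Tb _]]]; last by have := Tb : T a (r0 TL) b; rewrite x_a => /zero_no_tl.
    by have [n ny fn] := f_sound _ _ _ zs_m Tf; exists n => //; constructor.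
  case: sat_step => [[a0 _]|[b _ [Tb [n _ [[Tnb Tnm] [k _ [Tk [p _ [[Tpk Tpm] [q _ [[Tqb Tqp] Tq]]]]]]]]]]].
    by case: x_a => c Tc _; move: Tc; rewrite (a0 : a = r0 ZERO) => /zero_no_tl.
  have xb : rep x b by case: x_a => c Tc xc; rewrite (T_fun (Tb : T a (r0 TL) b) Tc).
  have [v vk cv] : exists2 v, rep v k & computes (PRec f g) (x :: zs) v.
    by apply: IHx Tk; exists b, m.
  have [w wy cw] : exists2 w, rep w y & computes g [:: x, v & zs] w.
    by apply: g_sound Tq; exists b, p; split=> //; exists k, m.
  by exists w => //; apply: computes_recS cv cw.
- case: chks => chk_s /IHf f_sound.
  (* Here [d] is the fuel of the search. The candidate [x] grows by one at each step and [rep_bound]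
     keeps it at most [size dom], so the fuel cannot run out. *)
  suff search_sound d x zs l' y' : size dom < x + d -> rep_list (x :: zs) l' ->
      T l' (r0 (sattr f)) y' -> exists n (k : nat -> nat), [/\ rep n y', x <= n,
        computes f (n :: zs) 0 &
        forall j, x <= j < n -> computes f (j :: zs) (k j).+1].
    case: sat_step => n _ [[Tn0 TnL] Ty].
    have [|v [k [vy _ fv fk]]] := @search_sound (size dom).+1 0 xs n y (ltnSn _) _ Ty.
      by exists (r0 ZERO), l.
    by exists v => //; apply: (@computes_mu _ _ _ k).
  elim: d x l' y' {sat_step xs_l chk l y Tl} => [|d IHd] x l y lt_x xs_l Tl.
    case: (xs_l) => a [m [_ _ /rep_bound + _]].
    by rewrite leqNgt => /negP[]; rewrite -[x]addn0.
  have [a _ [m _ [[Ta Tm]]]] :=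
    @check_sat (sattr f) (search_fo f) l y erefl erefl chk_s Tl.
  have [_ [_ [[<- <-] x_a zs_m]]] := rep_list_cons xs_l (Ta : T l (r0 HD) a) (Tm : T l (r0 TL) m).
  case=> b _ [Tb].
  have [v v_b fv] := f_sound _ _ b xs_l Tb.
  case=> [[b0 ya]|[n _ [Tbn [p _ [Tpa [q _ [[Tqp Tqm] Tq]]]]]]].
    have v0 : v = 0 by apply: rep_fun v_b _; exact: b0.
    (* The search stops at once; the range of [j] is empty, and [id] is an arbitrary choice. *)
    exists x, id; rewrite v0 in fv; split=> //; first by rewrite (ya : y = a).
    by move=> j /andP[/leq_ltn_trans /[apply]]; rewrite ltnn.
  case: v v_b fv => [b0|v _ fv]; first by have := Tbn : T b (r0 TL) n; rewrite b0 => /zero_no_tl.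
  have [||w [k [wy lt_xw fw fk]]] := IHd x.+1 q y _ _ Tq.
  - by rewrite addSnnS.
  - by exists p, m; split=> //; exists a.
  exists w, (fun j => if j == x then v else k j); split=> //; first exact: ltnW.
  move=> j /andP[]; rewrite leq_eqVlt eq_sym; case: eqVneq => [-> _ _ //|_ /= lt_xj lt_jw].
  by apply: fk; rewrite lt_xj.
Qed.

End Soundness.

(** * Completeness: finite tables of true claims *)

Fixpoint positive (phi : fo) : bool :=
  match phi with
  | Rel _ _ _ | Eqv _ _ => true
  | Neg _ => false
  | Conj phi psi | Disj phi psi => positive phi && positive psi
  | Ex _ phi => positive phi
  end.

(** When the relation grows, so does the set of occurring elements, and existential witnesses remain
    available. *)
Lemma positive_sat (X : Type) (T T' : X -> X -> X -> Prop) phi r :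
  positive phi -> (forall a b c, T a b c -> T' a b c) -> sat T phi r -> sat T' phi r.
Proof.
move=> + TT'; elim: phi r => [x y z|x y|phi IH|phi IH1 psi IH2|phi IH1 psi IH2|x phi IH] r //=.
- by move=> _ /TT'.
- by case/andP=> /IH1 p1 /IH2 p2 [/p1 s1 /p2 s2].
- by case/andP=> /IH1 p1 /IH2 p2 [/p1|/p2]; [left|right].
- move=> /IH p [a [b [c occ]] s]; exists a; last exact: p.
  by exists b, c; case: occ => [|[|]] /TT'; [left|right; left|right; right].
Qed.

(** All programs are treated at once, so that tables made for different programs can be merged. *)
Definition rule (v : nat) (phi : fo) : Prop :=
  (exists2 f, v = attr f & phi = step_fo f) \/ (exists2 f, v = sattr f & phi = search_fo f).

Lemma attr_inj : injective attr.
Proof. by move=> f g [/(congr1 half)]; rewrite !doubleK => /code_prf_inj. Qed.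

Lemma sattr_inj : injective sattr.
Proof. by move=> f g [/(congr1 half)]; rewrite !doubleK => /code_prf_inj. Qed.

Lemma attr_neq_sattr f g : attr f <> sattr g.
Proof. by case=> /(congr1 odd); rewrite /= !odd_double. Qed.

Lemma rule_fun v phi psi : rule v phi -> rule v psi -> phi = psi.
Proof.
case=> -[f -> ->] -[] [g] => [/attr_inj-> -> //|/attr_neq_sattr //||/sattr_inj-> -> //].
by move/esym/attr_neq_sattr.
Qed.

Lemma rule_positive v phi : rule v phi -> positive phi.
Proof.
case=> -[f _ ->] //; case: f => //= [i|f gs]; first by elim: i.
by rewrite andbT; elim: gs.
Qed.

Lemma rule_ge v phi : rule v phi -> 16 <= v.
Proof. by case=> -[f -> _]. Qed.

(* The intended structure: variables stand for themselves, lists for themselves,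
   and numbers for lists of zeros; the only role of the attribute MARK is to make
   prescribed elements occur in a triple. *)
Definition elt : Type := (nat + seq nat)%type.

Definition num (n : nat) : elt := inr (nseq n 0).

Definition least_zero f m xs n : Prop :=
  [/\ m <= n, computes f (n :: xs) 0 &
    forall j, m <= j < n -> exists k, computes f (j :: xs) k.+1].

Lemma least_zero_fun f m xs n n' : least_zero f m xs n -> least_zero f m xs n' -> n = n'.
Proof.
suff least_le k k' : least_zero f m xs k -> least_zero f m xs k' -> k <= k'.
  by move=> h h'; apply/eqP; rewrite eqn_leq !least_le.
move=> [_ _ lt] [le_mk' z _]; rewrite leqNgt; apply/negP => lt_kk'.
by have [|y /(computes_fun z)] := lt k' _; first by rewrite le_mk'.
Qed.

Inductive true_triple : elt -> elt -> elt -> Prop :=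
| true_hd x xs : true_triple (inr (x :: xs)) (inl HD) (num x)
| true_tl x xs : true_triple (inr (x :: xs)) (inl TL) (inr xs)
| true_tag f xs y : computes f xs y -> true_triple (inr xs) (inl (attr f)) (num y)
| true_stag f m xs n : least_zero f m xs n ->
    true_triple (inr (m :: xs)) (inl (sattr f)) (num n)
| true_mark x : true_triple x (inl MARK) x.

(** This gives the functionality axiom in every table of true triples, however it was assembled. *)
Lemma true_triple_fun x y z w : true_triple x y z -> true_triple x y w -> z = w.
Proof.
move=> t t'; inversion t as [u us|u us|f us v c e1 e2|f m us n lz e1 e2|u] => {t}; subst;
  inversion t' as [u' us'|u' us'|f' us' v' c' e1 e2|f' m' us' n' lz' e1 e2|u'] => {t'}; subst => //.
- have ef := code_prf_inj (double_inj e2); subst; by rewrite (computes_fun c c').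
- by have := congr1 odd e2; rewrite /= !odd_double.
- by have := congr1 odd e2; rewrite /= !odd_double.
- have ef := code_prf_inj (double_inj e2); subst; by rewrite (least_zero_fun lz lz').
Qed.

Section Completeness.
Variable input : nat.

Definition rho (v : nat) : elt :=
  if v == ZERO then inr [::] else if v == INPUT then num input else inl v.

Definition holds (S : seq (elt * elt * elt)) (x y z : elt) : Prop := (x, y, z) \in S.

Definition justified (S : seq (elt * elt * elt)) : Prop :=
  (forall x y z, holds S x y z -> true_triple x y z) /\
  (forall v phi l y, rule v phi -> holds S l (inl v) y ->
     sat (holds S) phi (upd (upd rho vL l) vY y)).

(** Rules are positive, so a justification within one table persists in the union. *)
Lemma justified_cat S1 S2 : justified S1 -> justified S2 -> justified (S1 ++ S2).
Proof.
move=> [t1 c1] [t2 c2]; split=> [x y z|v phi l y r_v].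
  by rewrite /holds mem_cat => /orP[/t1|/t2].
rewrite {1}/holds mem_cat => /orP[/(c1 _ _ _ _ r_v)|/(c2 _ _ _ _ r_v)];
  by apply: positive_sat (rule_positive r_v) _ => a b c; rewrite /holds mem_cat => ->; rewrite ?orbT.
Qed.

Lemma justified_cons S v phi l y : justified S -> rule v phi -> true_triple l (inl v) y ->
  sat (holds S) phi (upd (upd rho vL l) vY y) -> justified ((l, inl v, y) :: S).
Proof.
move=> [t c] r_v t_v s; split=> [a b d|v' phi' l' y' r_v'].
  by rewrite /holds inE => /predU1P[[-> -> ->]|/t].
rewrite {1}/holds inE => /predU1P[[-> ev ->]|/(c _ _ _ _ r_v')] {c}.
  rewrite ev in r_v'; rewrite -(rule_fun r_v r_v') {v' ev r_v'}.
  by apply: positive_sat (rule_positive r_v) _ s => a b d; rewrite /holds inE => ->; rewrite orbT.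
by apply: positive_sat (rule_positive r_v') _ => a b d; rewrite /holds inE => ->; rewrite orbT.
Qed.

(** Attributes below 16 fall under no rule, so such triples have nothing to justify. *)
Lemma justified_struct S : (forall x y z, holds S x y z -> true_triple x y z /\
  exists2 v, y = inl v & v < 16) -> justified S.
Proof.
move=> S_ok; split=> [x y z /S_ok[]//|v phi l y /rule_ge v_ge /S_ok[_ [w [ev] lt_w]]].
by move: v_ge; rewrite ev leqNgt lt_w.
Qed.

Definition nat_triples n : seq (elt * elt * elt) :=
  [seq (num k.+1, inl TL, num k) | k <- iota 0 n].

Fixpoint list_triples (xs : seq nat) : seq (elt * elt * elt) :=
  if xs is x :: xs' then
    [:: (inr xs, inl HD, num x), (inr xs, inl TL, inr xs') & list_triples xs']
  else [::].

Lemma justified_nat n : justified (nat_triples n).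
Proof.
apply: justified_struct => x y z /mapP[k _ [-> -> ->]]; split; last by exists TL.
exact: true_tl.
Qed.

Lemma justified_list xs : justified (list_triples xs).
Proof.
apply: justified_struct => a b c; elim: xs => [//|x xs IH].
rewrite /holds !inE => /or3P[/eqP[-> -> ->]|/eqP[-> -> ->]|/IH //].
  by split; [exact: true_hd|exists HD].
by split; [exact: true_tl|exists TL].
Qed.

Lemma nat_tl n k : k < n -> holds (nat_triples n) (num k.+1) (inl TL) (num k).
Proof. by move=> lt_kn; apply/mapP; exists k; rewrite ?mem_iota. Qed.

Definition fact f xs y S := holds S (inr xs) (inl (attr f)) (num y).

Lemma facts_family n f xs y : (forall i, i < n -> exists2 S, justified S & fact (f i) (xs i) (y i) S) ->
  exists2 S, justified S & forall i, i < n -> fact (f i) (xs i) (y i) S.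
Proof.
elim: n => [|n IH] facts; first by exists [::] => //; apply: justified_struct.
have [|S gS fS] := IH; first by move=> i lt_i; apply: facts; exact: ltnW.
have [S' gS' fS'] := facts n (ltnSn n).
exists (S' ++ S); first exact: justified_cat.
move=> i; rewrite ltnS leq_eqVlt /fact /holds mem_cat => /predU1P[->|/fS ->]; last exact: orbT.
by rewrite [_ \in S']fS'.
Qed.

Lemma holds_catl S S' a b c : holds S a b c -> holds (S ++ S') a b c.
Proof. by rewrite /holds mem_cat => ->. Qed.

Lemma holds_catr S S' a b c : holds S' a b c -> holds (S ++ S') a b c.
Proof. by rewrite /holds mem_cat => ->; rewrite orbT. Qed.

Lemma list_hd S x xs : holds (list_triples (x :: xs) ++ S) (inr (x :: xs)) (inl HD) (num x).
Proof. by rewrite /holds inE eqxx. Qed.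

Lemma list_tl S x xs : holds (list_triples (x :: xs) ++ S) (inr (x :: xs)) (inl TL) (inr xs).
Proof. by rewrite /holds !inE eqxx orbT. Qed.

Section Witnesses.
Variable S : seq (elt * elt * elt).

(** A witness must occur in the relation; here and in [sat_ex3] a triple having it as an end
    component certifies this. *)
Lemma sat_ex1 x phi r a b c : holds S a b c -> sat (holds S) phi (upd r x a) ->
  sat (holds S) (Ex x phi) r.
Proof. by move=> /occurs3[oa _ _]; exists a. Qed.

Lemma sat_ex3 x phi r a b c : holds S a b c -> sat (holds S) phi (upd r x c) ->
  sat (holds S) (Ex x phi) r.
Proof. by move=> /occurs3[_ _ oc]; exists c. Qed.

Lemma proj_sat xs i r : i < size xs -> {subset list_triples xs <= S} ->
  r vL = inr xs -> r HD = inl HD -> r TL = inl TL -> r vY = num (nth 0 xs i) ->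
  sat (holds S) (proj_fo i) r.
Proof.
elim: xs i r => [//|x xs IH] i r lt_i xs_S rL rH rT rY.
have hd : holds S (inr (x :: xs)) (inl HD) (num x) by apply: xs_S; exact: mem_head.
have tl : holds S (inr (x :: xs)) (inl TL) (inr xs) by apply: xs_S; rewrite !inE eqxx orbT.
case: i lt_i rY => [_ rY|i lt_i rY]; apply: (sat_ex3 tl).
  by split=> /=; rewrite /upd /= ?rL ?rH ?rT ?rY.
split; first by rewrite /= /upd /= rL rT.
apply: (sat_ex3 tl); split=> //; apply: IH => // t t_xs; apply: xs_S.
by rewrite !inE t_xs !orbT.
Qed.

Lemma args_sat gs xs ys r : size ys = size gs -> {subset list_triples ys <= S} ->
  (forall i, i < size gs -> fact (nth PZero gs i) xs (nth 0 ys i) S) ->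
  r vL = inr xs -> r vM = inr ys -> r HD = inl HD -> r TL = inl TL -> r ZERO = inr [::] ->
  (forall g, r (attr g) = inl (attr g)) ->
  sat (holds S) (args_fo gs) r.
Proof.
elim: gs ys r => [|g gs IH] [|y ys] r // sz ys_S facts rL rM rH rT rZ rA.
  by rewrite /= rM rZ.
have {}sz : size ys = size gs by case: sz.
have hd : holds S (inr (y :: ys)) (inl HD) (num y) by apply: ys_S; exact: mem_head.
have tl : holds S (inr (y :: ys)) (inl TL) (inr ys) by apply: ys_S; rewrite !inE eqxx orbT.
apply: (sat_ex3 hd); apply: (sat_ex3 tl); split.
  by split; rewrite /= /upd /= ?rM ?rH ?rT.
split; first by have := facts 0 isT; rewrite /fact -rL -(rA g).
apply: (sat_ex3 tl); split=> //; apply: (IH ys) => //.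
  by move=> t t_ys; apply: ys_S; rewrite !inE t_ys !orbT.
by move=> i lt_i; apply: (facts i.+1).
Qed.

End Witnesses.

Lemma fact_cons S f xs y : justified S -> computes f xs y ->
  sat (holds S) (step_fo f) (upd (upd rho vL (inr xs)) vY (num y)) ->
  exists2 S', justified S' & fact f xs y S'.
Proof.
move=> gS c s; exists ((inr xs, inl (attr f), num y) :: S); last exact: mem_head.
by apply: justified_cons s => //; [left; exists f|exact: true_tag].
Qed.

(** Along the computation, the tables of the subcomputations are merged with the lists and numbers
    that the rule mentions, and the new claim is put in front. *)
Lemma computes_fact f xs y : computes f xs y -> exists2 S, justified S & fact f xs y S.
Proof.
move=> c; have := c; elim: c => {f xs y} [xs|x xs|i xs lt_i|f gs xs ys y sz cs IHs cf IHf
  |f g xs y cf IHf|f g n xs r y cr IHr cg IHg|f xs n k cs IHs c0 IH0] c.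
- by apply: (fact_cons (S := [::])) => //; apply: justified_struct.
- pose S := list_triples (x :: xs) ++ nat_triples x.+1.
  apply: (fact_cons (S := S)) c _; first exact: justified_cat (justified_list _) (justified_nat _).
  apply: (sat_ex3 (list_hd _ _ _)); apply: (sat_ex3 (list_tl _ _ _)); split; first split.
  + exact: list_hd.
  + exact: list_tl.
  + exact: holds_catr (nat_tl (ltnSn x)).
- apply: fact_cons (justified_list xs) c _; by apply: (@proj_sat _ xs i).
- have [S1 g1 f1] : exists2 S, justified S & forall i, i < size gs ->
      fact (nth PZero gs i) xs (nth 0 ys i) S.
    by apply: facts_family => i lt_i; apply: IHs => //; exact: cs.
  have [S2 g2 f2] := IHf cf.
  apply: (fact_cons (S := list_triples ys ++ (S1 ++ S2))) c _.
    by apply: justified_cat (justified_list _) _; exact: justified_cat.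
  have f2' : fact f ys y (list_triples ys ++ (S1 ++ S2)) by do 2!apply: holds_catr.
  apply: (sat_ex1 f2'); split=> //; apply: (@args_sat _ gs xs ys) => //.
  + by move=> t t_ys; rewrite mem_cat t_ys.
  + by move=> i lt_i; apply: holds_catr; apply: holds_catl; exact: f1.
- have [S gS fS] := IHf cf.
  apply: (fact_cons (S := list_triples (0 :: xs) ++ S)) c _.
    exact: justified_cat (justified_list _) gS.
  apply: (sat_ex3 (list_hd _ _ _)); apply: (sat_ex3 (list_tl _ _ _)); split; first split.
  + exact: list_hd.
  + exact: list_tl.
  + by left; split=> //; apply: holds_catr.
- have [S1 g1 f1] := IHr cr; have [S2 g2 f2] := IHg cg.
  (* The argument list, the list of the recursive call, the lists building the arguments of [g], the
     numbers down from [n.+1], and the tables of the two subcomputations. *)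
  pose S3 := list_triples (n.+1 :: xs) ++ (list_triples (n :: xs) ++
    (list_triples (r :: xs) ++ (list_triples [:: n, r & xs] ++ (nat_triples n.+1 ++ (S1 ++ S2))))).
  have l1 : {subset list_triples (n.+1 :: xs) <= S3} by move=> t t_l; rewrite !mem_cat t_l ?orbT.
  have l2 : {subset list_triples (n :: xs) <= S3} by move=> t t_l; rewrite !mem_cat t_l ?orbT.
  have l3 : {subset list_triples (r :: xs) <= S3} by move=> t t_l; rewrite !mem_cat t_l ?orbT.
  have l4 : {subset list_triples [:: n, r & xs] <= S3} by move=> t t_l; rewrite !mem_cat t_l ?orbT.
  have hd x us : {subset list_triples (x :: us) <= S3} -> holds S3 (inr (x :: us)) (inl HD) (num x).
    by apply; exact: mem_head.
  have tl x us : {subset list_triples (x :: us) <= S3} -> holds S3 (inr (x :: us)) (inl TL) (inr us).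
    by apply; rewrite !inE eqxx orbT.
  have pred_n : holds S3 (num n.+1) (inl TL) (num n).
    by do 4!apply: holds_catr; apply: holds_catl; exact: nat_tl.
  have f1' : fact (PRec f g) (n :: xs) r S3 by do 5!apply: holds_catr; exact: holds_catl.
  have f2' : fact g [:: n, r & xs] y S3 by do 6!apply: holds_catr.
  apply: (fact_cons (S := S3)) c _.
    by do !apply: justified_cat => //; (exact: justified_list || exact: justified_nat).
  apply: (sat_ex3 (hd _ _ l1)); apply: (sat_ex3 (tl _ _ l1)); split.
    by split; [exact: hd l1|exact: tl l1].
  right; apply: (sat_ex3 pred_n); split=> //.
  apply: (sat_ex1 (hd _ _ l2)); split; first by split; [exact: hd l2|exact: tl l2].
  apply: (sat_ex3 f1'); split=> //.
  apply: (sat_ex1 (hd _ _ l3)); split; first by split; [exact: hd l3|exact: tl l3].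
  apply: (sat_ex1 (hd _ _ l4)); split=> //; split; [exact: hd l4|exact: tl l4].
- have [S0 g0 f0] : exists2 S, justified S & forall i, i < n.+1 ->
      fact f (i :: xs) (if i < n then (k i).+1 else 0) S.
    apply: (@facts_family n.+1 (fun=> f) (fun i => i :: xs)) => i; rewrite ltnS leq_eqVlt.
    by move=> /predU1P[->|lt_i]; [rewrite ltnn; exact: IH0|rewrite lt_i; exact: IHs (cs _ lt_i)].
  have lz m : m <= n -> least_zero f m xs n.
    by move=> le_mn; split=> // j /andP[_ lt_jn]; exists (k j); exact: cs.
  (* The search is traced backwards from the zero [n]: [d] is the distance from the current
     candidate to [n]. *)
  have search d : d <= n -> exists2 S, justified S &
      holds S (inr (n - d :: xs)) (inl (sattr f)) (num n).
    elim: d => [_|d IHd lt_dn].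
      pose S := list_triples (n :: xs) ++ S0.
      exists ((inr (n :: xs), inl (sattr f), num n) :: S); last by rewrite subn0; exact: mem_head.
      apply: justified_cons; first exact: justified_cat (justified_list _) g0.
      + by right; exists f.
      + exact: true_stag (lz _ (leqnn _)).
      apply: (sat_ex3 (list_hd _ _ _)); apply: (sat_ex3 (list_tl _ _ _)); split; first split.
      + exact: list_hd.
      + exact: list_tl.
      have fn : fact f (n :: xs) 0 S by have := f0 n (ltnSn n); rewrite ltnn; exact: holds_catr.
      by apply: (sat_ex3 fn); split=> //; left.
    have [S gS Sd] := IHd (ltnW lt_dn).
    have em : n - d = (n - d.+1).+1 by rewrite -subnSK.
    have lt_mn : n - d.+1 < n by rewrite -em leq_subr.
    move: (n - d.+1) em lt_mn => m em lt_mn; rewrite em in Sd.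
    pose S3 := list_triples (m :: xs) ++ (list_triples (m.+1 :: xs) ++
      (nat_triples (k m).+1 ++ (nat_triples m.+1 ++ (S0 ++ S)))).
    exists ((inr (m :: xs), inl (sattr f), num n) :: S3); last exact: mem_head.
    apply: justified_cons.
    + by do !apply: justified_cat => //; (exact: justified_list || exact: justified_nat).
    + by right; exists f.
    + exact: true_stag (lz _ (ltnW lt_mn)).
    apply: (sat_ex3 (list_hd _ _ _)); apply: (sat_ex3 (list_tl _ _ _)); split; first split.
    + exact: list_hd.
    + exact: list_tl.
    have fm : fact f (m :: xs) (k m).+1 S3.
      by do 4!apply: holds_catr; apply: holds_catl; have := f0 m (ltnW lt_mn); rewrite lt_mn.
    have tk : holds S3 (num (k m).+1) (inl TL) (num (k m)).
      by do 2!apply: holds_catr; apply: holds_catl; exact: nat_tl.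
    have tm : holds S3 (num m.+1) (inl TL) (num m).
      by do 3!apply: holds_catr; apply: holds_catl; exact: nat_tl.
    have hd : holds S3 (inr (m.+1 :: xs)) (inl HD) (num m.+1) by apply: holds_catr; exact: list_hd.
    have tl : holds S3 (inr (m.+1 :: xs)) (inl TL) (inr xs) by apply: holds_catr; exact: list_tl.
    have sm : holds S3 (inr (m.+1 :: xs)) (inl (sattr f)) (num n) by do 5!apply: holds_catr.
    apply: (sat_ex3 fm); split=> //; right.
    apply: (sat_ex3 tk); split=> //; apply: (sat_ex1 tm); split=> //.
    by apply: (sat_ex1 hd); split.
  have [S gS] := search n (leqnn n); rewrite subnn => S_n.
  apply: (fact_cons (S := list_triples (0 :: xs) ++ S)) c _.
    exact: justified_cat (justified_list _) gS.
  apply: (sat_ex1 (list_hd _ _ _)); split; last exact: holds_catr.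
  by split; [exact: list_hd|exact: list_tl].
Qed.

End Completeness.
(** * The reduction *)

(** Passes from the number at [INPUT] to a successor; [vY] holds the successor while [INPUT] is
    rebound. *)
Definition next_input phi :=
  Ex vY (Conj (Rel vY TL INPUT) (Ex INPUT (Conj (Eqv INPUT vY) phi))).

Definition at_input n phi :=
  Ex ZERO (Ex TL (Ex INPUT (Conj (Eqv INPUT ZERO) (iter n next_input phi)))).

(** The range starts after the three variables bound by [at_input] and passes every free variable of
    [halts_fo f]; the summand 3 puts [vY] in it too, so the changes that [next_input] makes to [vY]
    are overwritten. *)
Definition bound_vars f : seq nat :=
  iota 3 (3 + \max_(x <- enum_fset (FV (tr (halts_fo f)))) x).

Definition closed_halts f := foldr Ex (halts_fo f) (bound_vars f).

Lemma FV_Ex x phi v : (v.+3 \in FV (tr (Ex x phi))) = (v != x) && (v.+3 \in FV (tr phi)).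
Proof. by rewrite /= !inE /= !eqSS. Qed.

Lemma FV_exs vs phi v :
  (v.+3 \in FV (tr (foldr Ex phi vs))) = (v \notin vs) && (v.+3 \in FV (tr phi)).
Proof. by elim: vs => [|x vs IH] //; rewrite [foldr _ _ _]/= FV_Ex IH inE negb_or andbA. Qed.

Lemma FV_closed_halts f v : v.+3 \in FV (tr (closed_halts f)) -> v < 3.
Proof.
have [//|v_ge] := ltnP v 3; rewrite FV_exs => /andP[v_out v_f].
have /ltnW/ltnW v_lt := @leq_bigmax_seq _ _ xpredT id _ v_f isT.
by case/negP: v_out; rewrite mem_iota v_ge; do 2!apply: leq_trans (leq_addl 3 _).
Qed.

Lemma FV_Conj phi psi v :
  (v.+3 \in FV (tr (Conj phi psi))) = (v.+3 \in FV (tr phi)) || (v.+3 \in FV (tr psi)).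
Proof. by rewrite /= !inE. Qed.

Lemma FV_Rel x y z v : (v.+3 \in FV (tr (Rel x y z))) = (v \in [:: x; y; z]).
Proof. by rewrite /= !inE /= !eqSS !orbF. Qed.

Lemma FV_Eq x y v : (v.+3 \in FV (tr (Eqv x y))) = (v \in [:: x; y]).
Proof. by rewrite /= !inE /= !eqSS !orbF. Qed.

Lemma at_input_closed phi n :
  (forall v, v.+3 \in FV (tr phi) -> v < 3) -> fo_closed (at_input n phi).
Proof.
move=> FV_phi v; have FV_iter : v.+3 \in FV (tr (iter n next_input phi)) -> v < 3.
  elim: n => [|n IH]; first exact: FV_phi.
  rewrite iterS /next_input FV_Ex FV_Conj FV_Rel FV_Ex FV_Conj FV_Eq !inE.
  by case: v IH => [|[|[|[|[|[|v]]]]]].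
rewrite /at_input; move: (iter n next_input phi) FV_iter => psi FV_psi.
rewrite 3!FV_Ex FV_Conj FV_Eq !inE; apply/negP.
by case: v FV_psi => [|[|[|v]]] //= FV_psi /FV_psi.
Qed.

Lemma eq_rep (X : eqType) (T : X -> X -> X -> Prop) (r r' : nat -> X) n a :
  r ZERO = r' ZERO -> r TL = r' TL -> rep T r n a -> rep T r' n a.
Proof.
move=> r0 r1; elim: n a => [|n IH] a /=; first by rewrite r0.
by case=> b Tb /IH nb; exists b; rewrite -?r1.
Qed.

Lemma sat_iter_next (X : eqType) (T : X -> X -> X -> Prop) phi n m r :
  sat T (iter n next_input phi) r -> rep T r m (r INPUT) ->
  exists r', [/\ sat T phi r', r' ZERO = r ZERO, r' TL = r TL & rep T r' (m + n) (r' INPUT)].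
Proof.
elim: n m r => [|n IH] m r /=; first by exists r; rewrite ?addn0.
case=> y _ [Ty [i _ [iy s]]] m_r; rewrite (iy : i = y) in s.
have [|r' [s' r'0 r'1 rep']] := IH m.+1 _ s.
  by exists (r INPUT); [exact: Ty|apply: eq_rep m_r].
by exists r'; split; rewrite // addnS -addSn.
Qed.

Lemma at_input_sound (X : eqType) (T : X -> X -> X -> Prop) (dom : seq X) f n r :
  (forall a, occurs T a -> a \in dom) ->
  sat T (at_input n (closed_halts f)) r -> exists y, computes f [:: n] y.
Proof.
move=> T_dom [z _ [t _ [i _ [iz s]]]].
have [|r1 [/sat_exs_inv[r2 s2 r21] r10 r11 rep1]] := sat_iter_next (m := 0) s.
  exact: iz.
rewrite add0n in rep1.
have out v : v < 3 -> r2 v = r1 v.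
  by move=> v_lt; rewrite r21 // inE mem_iota leqNgt v_lt.
case: s2 => ax [chks [l _ [y _ [[Tn Tz] Ty]]]].
have f_sound := checks_sound T_dom ax chks.
have [|m _ fm] := f_sound [:: n] l y _ Ty; last by exists m.
exists (r2 INPUT), (r2 ZERO); split=> //.
by rewrite out //; apply: eq_rep rep1; rewrite out.
Qed.

Definition marks (vs : seq nat) : seq (elt * elt * elt) :=
  [seq (x, inl MARK, x) | x <- inr [::] :: map inl vs].

(** The table of the computation is extended by the input list, by the numbers up to [n], and by
    marks that make the intended values of the quantified variables occur. *)
Lemma at_input_complete f n y : computes f [:: n] y ->
  exists S r, sat (holds S) (at_input n (closed_halts f)) r.
Proof.
move=> /(computes_fact n)[S0 g0 f0].
pose S := list_triples [:: n] ++ (nat_triples n ++ (marks (TL :: bound_vars f) ++ S0)).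
have gS : justified n S.
  do !apply: justified_cat => //; [exact: justified_list|exact: justified_nat|].
  apply: justified_struct => a b c /mapP[x _ [-> -> ->]]; split; last by exists MARK.
  exact: true_mark.
have fS : fact f [:: n] y S by do 3!apply: holds_catr.
have hd : holds S (inr [:: n]) (inl HD) (num n) by exact: list_hd.
have tl : holds S (inr [:: n]) (inl TL) (inr [::]) by exact: list_tl.
pose ms : seq elt := inr [::] :: map inl (TL :: bound_vars f).
have mark x : x \in ms -> holds S x (inl MARK) x.
  by move=> x_vs; do 2!apply: holds_catr; apply: holds_catl; exact: map_f.
have [S_true S_rules] := gS.
have chk v phi : rule v phi -> sat (holds S) (check v phi) (rho n).
  move=> r_v; have v_ge := rule_ge r_v; case=> l _ [u _ [Tu]]; apply; apply: S_rules r_v _.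
  (* As [v] is at least 16, the updates at [vL] and [vY] do not affect it. *)
  move: Tu; rewrite /= /upd /=; case: v v_ge => [|[|[|[|[|[|v]]]]]] //.
have checks_S g : sat (holds S) (checks g) (rho n).
  elim/prf_nested_ind: g => [||i|g hs IHg IHhs|g h IHg IHh|g IHg]; split=> //;
    try by apply: chk; left; eexists.
  - split=> //; elim: hs IHhs => [|h hs IH] //= IHhs; split; first exact: (IHhs 0).
    by apply: IH => i; apply: (IHhs i.+1).
  - by split=> //; apply: chk; right; exists g.
have halts_S : sat (holds S) (halts_fo f) (rho n).
  split; first split.
  - by case=> a _ /S_true t; inversion t.
  - by case=> l _ [x _ [a _ [b _ [Ta [Tb]]]]]; apply;
      apply: true_triple_fun (S_true _ _ _ Ta) (S_true _ _ _ Tb).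
  - split; first exact: checks_S.
    by apply: (sat_ex1 hd); apply: (sat_ex3 fS).
have mTL : inl TL \in ms by rewrite !inE eqxx.
have m0 : inr [::] \in ms by exact: mem_head.
(* With [k] steps left, [INPUT] holds [n - k]; elsewhere the valuation may leave [rho n] only at
   variables that [closed_halts] binds again. *)
have iter_S k r : k <= n -> (forall v, v != INPUT -> v \notin bound_vars f -> r v = rho n v) ->
    r INPUT = num (n - k) -> sat (holds S) (iter k next_input (closed_halts f)) r.
  elim: k r => [|k IH] r lt_kn r_rho r_in.
    apply: sat_exs halts_S.
      move=> v; rewrite !inE => v_f; case: (eqVneq v INPUT) => [->|v_in].
        by rewrite r_in subn0.
      by rewrite r_rho.
    move=> v v_f; have v_gt : 2 < v by move: v_f; rewrite mem_iota => /andP[].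
    have -> : rho n v = inl v by case: v v_gt {v_f} => [|[|[|v]]].
    have vm : inl v \in ms.
      by rewrite inE; apply/orP; right; apply: map_f; rewrite inE v_f orbT.
    by case: (occurs3 (mark _ vm)).
  have em : n - k = (n - k.+1).+1 by rewrite subnSK.
  have tk : holds S (num (n - k)) (inl TL) (num (n - k.+1)).
    rewrite em; apply: holds_catr; apply: holds_catl; apply: nat_tl; rewrite -em; exact: leq_subr.
  have YF : vY \in bound_vars f by rewrite mem_iota.
  apply: (sat_ex1 tk); split.
    by rewrite /= /upd /= r_in r_rho // mem_iota.
  apply: (sat_ex1 tk); split=> //; apply: IH => //; first exact: ltnW.
  by move=> v v_in v_f; rewrite /upd (negbTE v_in); case: eqVneq => [e|_]; [rewrite e YF in v_f|exact: r_rho].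
exists S, (rho n); apply: (sat_ex1 (mark _ m0)).
apply: (sat_ex1 (mark _ mTL)); apply: (sat_ex1 (mark _ m0)); split=> //.
apply: iter_S => //; last by rewrite subnn.
by case=> [|[|[|v]]].
Qed.

(* Computability of the reduction *)
Local Opaque cpair.

Lemma computable1_cpairl a F : computable1 F -> computable1 (fun x => cpair a (F x)).
Proof. exact: (computable1_cpair (computable1_const a)). Qed.

(** Since [tr] is compositional, a context acts on codes through a function of the code of its
    hole. *)
Definition computable_context (C : fo -> fo) : Prop :=
  exists2 F, computable1 F & forall phi, code_expr (tr (C phi)) = F (code_expr (tr phi)).

Lemma computable_context_id : computable_context id.
Proof. by exists id; first exact: computable1_id. Qed.

Lemma computable_context_Conj psi C :
  computable_context C -> computable_context (fun phi => Conj psi (C phi)).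
Proof.
(* The tag 6 is that of [EFor], and 2 is the scratch variable over which [tr] loops for a
   conjunction. *)
case=> F cF eF; exists (fun c => cpair 6 (cpair 2 (cpair (code_expr (tr psi)) (F c)))).
  exact: (computable1_cpairl _ (computable1_cpairl _ (computable1_cpairl _ cF))).
by move=> phi; rewrite -eF; reflexivity.
Qed.

Lemma computable_context_Ex x C :
  computable_context C -> computable_context (fun phi => Ex x (C phi)).
Proof.
case=> F cF eF; exists (fun c => cpair 6 (cpair x.+3 (cpair (code_expr e_universe) (F c)))).
  exact: (computable1_cpairl _ (computable1_cpairl _ (computable1_cpairl _ cF))).
by move=> phi; rewrite -eF; reflexivity.
Qed.

Lemma reduction_computable : exists p, forall xs phi,
  computes p (code_expr (tr phi) :: xs)
    (code_expr (e_fail (at_input (code_expr (tr phi)) phi))).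
Proof.
have [F cF eF] : computable_context next_input.
  by apply/computable_context_Ex/computable_context_Conj/computable_context_Ex;
    apply/computable_context_Conj/computable_context_id.
have [G cG eG] : computable_context (fun phi => Ex ZERO (Ex TL (Ex INPUT (Conj (Eqv INPUT ZERO) phi)))).
  by do 3!apply/computable_context_Ex; apply/computable_context_Conj/computable_context_id.
have [H cH eH] : exists2 H, computable1 H & forall phi, code_expr (e_fail phi) = H (code_expr (tr phi)).
  exists (fun c => cpair 7 (cpair (cpair (code_expr (EVar 1)) (code_expr (EName EEmpty)))
    (cpair (code_expr EEmpty) (cpair 6 (cpair 2 (cpair c (code_expr (EChildren (EVar 1)))))))));
    last by move=> phi; reflexivity.
  apply: (computable1_cpairl _ (computable1_cpairl _ (computable1_cpairl _ _))).
  apply: (computable1_cpairl _ (computable1_cpairl _ _)).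
  exact: (computable1_cpair computable1_id (computable1_const _)).
have [p cp] := computable1_comp cH (computable1_comp cG (computable1_iter cF)).
exists p => xs phi; rewrite eH eG.
have code_iter n : code_expr (tr (iter n next_input phi)) = iter n F (code_expr (tr phi)).
  by elim: n => [|n IH]; [reflexivity|rewrite !iterS eF IH; reflexivity].
rewrite code_iter; move: (code_expr (tr phi)) => c; exact: (cp xs c).
Qed.

(** * Finite models made of atoms *)

Section Main.
Variable A : set nat.
Variable content : atom A -> {fset node A} -> atom A.
Variable concat : {fset atom A} -> atom A.

Lemma infinite_injection : infinite_set A -> exists h : nat -> atom A, injective h.
Proof.
move=> /infiniteP/card_leP[g]; have g_inj := @inj _ _ _ g.
exists (fun n => g (SigSub (mem_setT n))) => m n /g_inj.
by rewrite !in_setT => /(_ isT isT)[].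
Qed.

Lemma occurs_finite (W : value A) :
  exists dom : seq (atom A), forall a, occurs (rel_of W) a -> a \in dom.
Proof.
(* The components of a triple are picked by choice; [triple_inj] shows that they are the expected
   ones. *)
pose parts (i : item A) : seq (atom A) :=
  if pselect (exists abc, i = triple abc.1.1 abc.1.2 abc.2) is left e
  then [:: (projT1 (cid e)).1.1; (projT1 (cid e)).1.2; (projT1 (cid e)).2] else [::].
have partsE a b c : parts (triple a b c) = [:: a; b; c].
  rewrite /parts; case: pselect => [e|[]]; last by exists (a, b, c).
  by case: (cid e) => -[[a' b'] c'] /= /triple_inj[<- <- <-].
exists (flatten [seq parts i | i <- enum_fset W]) => a [b [c occ]].
apply/flatten_mapP; case: occ => [Wi|[Wi|Wi]];
  [exists (triple a b c)|exists (triple b a c)|exists (triple b c a)] => //;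
  by rewrite partsE !inE eqxx ?orbT.
Qed.

(** If [f] halts, its table over the countable type [elt] is embedded into the infinite set of
    atoms, giving an input that makes the expression fail. Conversely, an input causing failure is a
    finite model, to which soundness applies. *)
Lemma e_fail_at_input f n : infinite_set A ->
  well_defined content concat (e_fail (at_input n (closed_halts f))) assignment <->
  ~ exists y, computes f [:: n] y.
Proof.
move=> A_inf; have psi_closed : fo_closed (at_input n (closed_halts f)).
  by apply: at_input_closed => v; exact: FV_closed_halts.
rewrite (well_defined_e_fail content concat psi_closed);
  split=> [nsat [y /at_input_complete[S [r s]]]|ncomp W t r _ _ s].
  have [h h_inj] := infinite_injection A_inf.
  pose emb (x : elt) := h (choice.pickle x).
  have emb_inj : injective emb by move=> x x' /h_inj/(pcan_inj choice.pickleK).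
  pose W : value A := [fset triple (emb u.1.1) (emb u.1.2) (emb u.2) | u in S].
  (* Of the two distinct atoms [h 0] and [h 1], at least one differs from [concat fset0]. *)
  have [t t_neq] : exists t, t != concat fset0.
    have [e0|] := eqVneq (h 0) (concat fset0); last by exists (h 0).
    by exists (h 1); rewrite -e0 (inj_eq h_inj).
  apply: (nsat W t (emb \o r) _ t_neq).
    by move=> i /imfsetP[[[x x'] x''] _ ->]; apply/in_triple_type; exists (emb x), (emb x'), (emb x'').
  have W_S a b c : rel_of W a b c <-> exists x x' x'',
      [/\ holds S x x' x'', a = emb x, b = emb x' & c = emb x''].
    split=> [/imfsetP[[[x x'] x''] uS]|].
    by move=> /triple_inj[-> -> ->]; exists x, x', x''.
  by move=> [x [x' [x'' [uS -> -> ->]]]]; apply/imfsetP; exists (x, x', x'').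
  exact: (proj2 (sat_transport emb_inj W_S _ _) s).
have [dom W_dom] := occurs_finite W.
by apply: ncomp; apply: (at_input_sound W_dom s).
Qed.

End Main.

Theorem theorem1 (A : set nat)
  (A_infinite : infinite_set A)
  (A_re : recursively_enumerable A)
  (content : atom A -> {fset node A} -> atom A)
  (content_computable : computable_content content)
  (concat : {fset atom A} -> atom A)
  (concat_computable : computable_concat concat) :
  ~ (exists f : prf,
       forall (e : expr) (G : {fmap var -> rxtype}),
         domf G = FV e ->
         exists b : bool,
           computes f [:: code_expr e; code_assignment G] (nat_of_bool b) /\
           (b = true <-> well_defined content concat e G)).
Proof.
case=> f f_dec; have [p cp] := reduction_computable.
have [q cq] := const_computable (code_assignment assignment).
(* On 0 and 1 this is boolean negation: the search in [g] looks for a zero, so answer 1 of [f] must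
   become 0. *)
pose nonzero := PRec (PComp PSucc [:: PZero]) PZero.
have c_nonzero (b : bool) : computes nonzero [:: nat_of_bool b] (nat_of_bool (~~ b)).
  have c0 : computes nonzero [:: 0] 1.
    by constructor; apply: computes_comp1 (computes_succ 0 [::]); constructor.
  by case: b => //; apply: computes_recS c0 _; constructor.
(* g halts on n = code_expr (tr phi) exactly when f accepts the instance
   built from phi at input n. *)
pose g := PMu (PComp nonzero [:: PComp f [:: PComp p [:: PProj 1]; q]]).
pose phi := closed_halts g; pose n := code_expr (tr phi).
have [|b [fb bP]] := f_dec (e_fail (at_input n phi)) assignment.
  by rewrite FV_e_fail //; apply: at_input_closed => v; exact: FV_closed_halts.
(* The result does not depend on the candidate [m], so the search stops at 0 or never. *)
have cb m : computes (PComp nonzero [:: PComp f [:: PComp p [:: PProj 1]; q]]) [:: m; n] (~~ b).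
  apply: computes_comp1 (c_nonzero b); apply: computes_comp2 (cq _) fb.
  by apply: computes_comp1 (cp [::] phi); apply: (@computes_proj 1).
have := e_fail_at_input content concat g n A_infinite; rewrite -/phi -bP => haltsP.
case: b cb haltsP {fb bP} => cb haltsP.
  have [/(_ erefl) + _] := haltsP; apply; exists 0.
  by apply: (@computes_mu _ _ _ id) (cb 0).
have [_ nhalts] := haltsP; suff : false = true by [].
apply: nhalts => -[y cy]; inversion cy as [| | | | | |? ? ? k _ c0]; subst.
by have := computes_fun c0 (cb y).
Qed.
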